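(* Let $k$ be a field, $S=k[x_1,\dots,x_n]$, $B\subset S$ an ideal generated by square-free monomials, and let $0\to M\xrightarrow{\rho}\mathbf{Z}^n\xrightarrow{\phi}\mathbf{D}\to 0$ be an exact sequence of abelian groups; regard $M$ as a subgroup of $\mathbf{Z}^n$ via $\rho$. Let $i\ge 0$ and suppose that $H^i_B(S)_\delta$ is a finite dimensional $k$-vector space for all $\delta\in\mathbf{D}$. If $I\in\Sigma_i$ and $p\in\mathbf{Z}^n$, then $(p+M)\cap(p_I+C_I)$ is contained in a bounded polyhedron. For $I\in\Sigma_i$, $j\in I$ and $\delta\in\mathbf{D}$, define $f_{I,j}(\delta)$ to be the maximum of zero and the negative of the minimum value of the $j$-th coordinates of the points in $(p+M)\cap(p_I+C_I)$, where $p\in\mathbf{Z}^n$ is any representative of $\delta$ (with $f_{I,j}(\delta)=0$ if this set is empty). Then for an integer $\ell\ge 0$ and $\delta\in\mathbf{D}$, $$\mathrm{Ext}^i_S(S/B^{[\ell]},S)_\delta=H^i_B(S)_\delta$$ (that is, the natural map from the left side to the right side is an isomorphism) if and only if $$\ell\ \ge\ \max\{f_{I,j}(\delta)\mid I\in\Sigma_i,\ j\in I\}.$$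
   Context: $S$ and $H^i_B(S)$ (local cohomology with supports in $B$) are $\mathbf{Z}^n$-graded with $\deg x_j=e_j$. A $\mathbf{Z}^n$-graded module $N$ is regarded as $\mathbf{D}$-graded by $N_\delta=\bigoplus_{p\in\phi^{-1}(\delta)}N_p$. $B^{[\ell]}$ is the ideal generated by the $\ell$-th powers of the monomials in $B$, and the natural map $\mathrm{Ext}^i_S(S/B^{[\ell]},S)\to H^i_B(S)$ is the one to the direct limit $H^i_B(S)=\varinjlim_\ell\mathrm{Ext}^i_S(S/B^{[\ell]},S)$. For $I\subset\{1,\dots,n\}$: $L_I=\{p\in\mathbf{Z}^n\mid\{j\mid p_j<0\}=I\}$; $C_I=\{p\in\mathbf{Z}^n\mid p_j\le0\text{ for }j\in I,\ p_j\ge0\text{ for }j\notin I\}$; $p_I\in\mathbf{Z}^n$ has $j$-th coordinate $-1$ if $j\in I$ and $0$ otherwise, so that $L_I=p_I+C_I$. The vector space $H^i_B(S)_p$ depends, up to isomorphism, only on $\{j\mid p_j<0\}$, and $\Sigma_i=\{I\subset\{1,\dots,n\}\mid H^i_B(S)_p\ne0\text{ for }p\in L_I\}$. The maximum over an empty set is taken to be $0$. *)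

(* Defs.v *)
From HB Require Import structures.
From mathcomp Require Import all_boot all_order all_algebra.
From mathcomp Require Import generic_quotient ring_quotient mpoly.
From mathcomp Require Import boolp classical_sets.

Set Implicit Arguments.
Unset Strict Implicit.
Unset Printing Implicit Defensive.

Import Order.TTheory GRing.Theory Num.Theory.

Local Open Scope ring_scope.
Local Open Scope quotient_scope.

Section QuotientModule.
Variables (R : nzRingType) (V : lmodType R) (W : submodClosed V).

Definition submod_pred : {pred V} := W.

HB.instance Definition _ := GRing.isZmodClosed.Build V submod_pred
  (GRing.submod_closedB (GRing.submodClosedP W)).

Definition quotmod : Type := Quotient.quot submod_pred.

HB.instance Definition _ := GRing.Zmodule.on quotmod.

Definition qclass (v : V) : quotmod := \pi_(Quotient.quot submod_pred) v.

Lemma qclassP (v w : V) : reflect (qclass v = qclass w) (v - w \in W).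
Proof.
change (reflect (qclass v = qclass w) (v - w \in (submod_pred : zmodClosed V))).
by rewrite Quotient.idealrBE; apply: eqP.
Qed.

Definition qrepr (x : quotmod) : V := repr (x : Quotient.quot submod_pred).

Lemma qreprK : cancel qrepr qclass.
Proof. exact: reprK. Qed.

Definition qscale (a : R) (x : quotmod) : quotmod := qclass (a *: qrepr x).

Lemma qclassD v w : qclass (v + w) = qclass v + qclass w.
Proof. exact: raddfD. Qed.

Lemma qscaleE a v : qscale a (qclass v) = qclass (a *: v).
Proof.
apply/qclassP; rewrite -scalerBr; apply: rpredZ.
by apply/qclassP; rewrite qreprK.
Qed.

Fact qscaleA a b x : qscale a (qscale b x) = qscale (a * b) x.
Proof. by rewrite -(qreprK x) !qscaleE scalerA. Qed.
Fact qscale1 : left_id 1 qscale.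
Proof. by move=> x; rewrite -(qreprK x) qscaleE scale1r. Qed.
Fact qscaleDr : right_distributive qscale +%R.
Proof.
by move=> a x y; rewrite -(qreprK x) -(qreprK y) -qclassD !qscaleE scalerDr qclassD.
Qed.
Fact qscaleDl x : {morph qscale^~ x : a b / a + b}.
Proof. by move=> a b; rewrite -(qreprK x) !qscaleE scalerDl qclassD. Qed.

HB.instance Definition _ := GRing.Zmodule_isLmodule.Build R quotmod
  qscaleA qscale1 qscaleDr qscaleDl.

Fact qclass_is_linear : linear qclass.
Proof. by move=> a v w; rewrite qclassD -qscaleE. Qed.

HB.instance Definition _ := GRing.isLinear.Build R V quotmod _ qclass
  qclass_is_linear.

End QuotientModule.

(* The homology at V of U --f--> V --g--> W, as cycles modulo boundaries. *)
Section Homology.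
Variables (R : nzRingType) (U V W : lmodType R).
Variables (f : {linear U -> V}) (g : {linear V -> W}).

Definition cycle_pred : {pred V} := fun v => g v == 0.

Fact cycle_pred_closed : submod_closed cycle_pred.
Proof.
split=> [|a v w]; rewrite !unfold_in ?linear0 // => /eqP gv /eqP gw.
by rewrite linearP gv gw scaler0 addr0.
Qed.

HB.instance Definition _ := GRing.isSubmodClosed.Build R V cycle_pred
  cycle_pred_closed.

Record cycles := Cycle { cycle_val :> V; cycleP : cycle_val \in cycle_pred }.

HB.instance Definition _ := [isSub for cycle_val].
HB.instance Definition _ := [Choice of cycles by <:].
HB.instance Definition _ := [SubChoice_isSubLmodule of cycles by <:].

Definition boundary_pred : {pred cycles} := fun z => `[< exists u, val z = f u >].

Fact boundary_pred_closed : submod_closed boundary_pred.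
Proof.
split=> [|a v w]; rewrite !unfold_in; first by apply/asboolP; exists 0; rewrite !linear0.
move=> /asboolP[x vx] /asboolP[y wy]; apply/asboolP; exists (a *: x + y).
by rewrite linearP -vx -wy; apply: (linearP (val : cycles -> V)).
Qed.

HB.instance Definition _ := GRing.isSubmodClosed.Build R cycles boundary_pred
  boundary_pred_closed.

Definition homology : lmodType R := quotmod boundary_pred.

Definition hclass (z : cycles) : homology := qclass boundary_pred z.

End Homology.

Section HomologyMap.
Variables (R : nzRingType) (U V W U' V' W' : lmodType R).
Variables (f : {linear U -> V}) (g : {linear V -> W}).
Variables (f' : {linear U' -> V'}) (g' : {linear V' -> W'}).
Variables (v : {linear V -> V'}).
Hypothesis cycv : forall z, g z = 0 -> g' (v z) = 0.
Hypothesis bndv : forall x, exists x', v (f x) = f' x'.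

Fact cycmap_subproof (z : cycles g) : v (val z) \in cycle_pred g'.
Proof. by rewrite unfold_in; apply/eqP/cycv/eqP; exact: cycleP z. Qed.

Definition cycmap (z : cycles g) : cycles g' := Cycle (cycmap_subproof z).

Definition homology_map (x : homology f g) : homology f' g' :=
  hclass f' (cycmap (qrepr x)).

Lemma homology_mapE z : homology_map (hclass f z) = hclass f' (cycmap z).
Proof.
apply/qclassP; set z1 := qrepr _.
have /qclassP : hclass f z1 = hclass f z by exact: qreprK.
rewrite !unfold_in => /asboolP[x xE].
have [x' x'E] := bndv x; apply/asboolP; exists x'.
by rewrite -x'E -xE; apply: esym; apply: (raddfB v).
Qed.

Fact homology_map_is_linear : linear homology_map.
Proof.
move=> a x y.
have xK : hclass f (qrepr x) = x by exact: qreprK.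
have yK : hclass f (qrepr y) = y by exact: qreprK.
have hlin : forall b z w, hclass f (b *: z + w) = b *: hclass f z + hclass f w.
  by move=> b z w; exact: (linearP (qclass _)).
rewrite -{1}xK -{1}yK -hlin homology_mapE.
rewrite [RHS](_ : _ = hclass f' (a *: cycmap (qrepr x) + cycmap (qrepr y))).
  by congr hclass; apply: val_inj; apply: (linearP v).
by apply: esym; exact: (linearP (qclass _)).
Qed.

Definition homology_linear : {linear homology f g -> homology f' g'} :=
  HB.pack homology_map (GRing.isLinear.Build R (homology f g)
    (homology f' g') _ homology_map homology_map_is_linear).

End HomologyMap.

(* The direct limit of E 0 -> E 1 -> E 2 -> ..., constructed as the quotient
   of the direct sum of the E l by the submodule generated by the elements
   in_l x - in_(l+1) (t l x). *)
Section DirectLimit.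
Variables (R : nzRingType) (E : nat -> lmodType R).
Variables (t : forall l, {linear E l -> E l.+1}).

Definition dprod : Type := forall l, E l.

HB.instance Definition _ := gen_eqMixin dprod.
HB.instance Definition _ := gen_choiceMixin dprod.

Definition dprod0 : dprod := fun _ => 0.
Definition dprod_opp (x : dprod) : dprod := fun l => - x l.
Definition dprod_add (x y : dprod) : dprod := fun l => x l + y l.
Definition dprod_scale (a : R) (x : dprod) : dprod := fun l => a *: x l.

Fact dprod_addA : associative dprod_add.
Proof. by move=> x y z; apply: functional_extensionality_dep => l; apply: addrA. Qed.
Fact dprod_addC : commutative dprod_add.
Proof. by move=> x y; apply: functional_extensionality_dep => l; apply: addrC. Qed.
Fact dprod_add0 : left_id dprod0 dprod_add.
Proof. by move=> x; apply: functional_extensionality_dep => l; apply: add0r. Qed.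
Fact dprod_addN : left_inverse dprod0 dprod_opp dprod_add.
Proof. by move=> x; apply: functional_extensionality_dep => l; apply: addNr. Qed.

HB.instance Definition _ := GRing.isZmodule.Build dprod
  dprod_addA dprod_addC dprod_add0 dprod_addN.

Fact dprod_scaleA a b x : dprod_scale a (dprod_scale b x) = dprod_scale (a * b) x.
Proof. by apply: functional_extensionality_dep => l; apply: scalerA. Qed.
Fact dprod_scale1 : left_id 1 dprod_scale.
Proof. by move=> x; apply: functional_extensionality_dep => l; apply: scale1r. Qed.
Fact dprod_scaleDr : right_distributive dprod_scale +%R.
Proof. by move=> a x y; apply: functional_extensionality_dep => l; apply: scalerDr. Qed.
Fact dprod_scaleDl x : {morph dprod_scale^~ x : a b / a + b}.
Proof. by move=> a b; apply: functional_extensionality_dep => l; apply: scalerDl. Qed.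

HB.instance Definition _ := GRing.Zmodule_isLmodule.Build R dprod
  dprod_scaleA dprod_scale1 dprod_scaleDr dprod_scaleDl.

Definition finsupp_pred : {pred dprod} :=
  fun x => `[< exists N, forall l, (N <= l)%N -> x l = 0 >].

Fact finsupp_pred_closed : submod_closed finsupp_pred.
Proof.
split=> [|a x y]; rewrite !unfold_in; first by apply/asboolP; exists 0%N.
move=> /asboolP[N xN] /asboolP[K yK]; apply/asboolP; exists (maxn N K) => l.
rewrite geq_max => /andP[Nl Kl]; change (a *: x l + y l = 0).
by rewrite xN // yK // scaler0 addr0.
Qed.

HB.instance Definition _ := GRing.isSubmodClosed.Build R dprod finsupp_pred
  finsupp_pred_closed.

Record dsum := Dsum { dsum_val : dprod; dsumP : dsum_val \in finsupp_pred }.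

HB.instance Definition _ := [isSub for dsum_val].
HB.instance Definition _ := [Choice of dsum by <:].
HB.instance Definition _ := [SubChoice_isSubLmodule of dsum by <:].

Definition inprod l (x : E l) : dprod :=
  @dfwith nat (fun m => E m) (fun _ => 0) l x.

Fact inprod_subproof l (x : E l) : inprod x \in finsupp_pred.
Proof.
rewrite unfold_in; apply/asboolP; exists l.+1 => m lm.
by rewrite /inprod dfwith_out // neq_ltn lm.
Qed.

Definition indsum l (x : E l) : dsum := Dsum (inprod_subproof x).

Definition shift (x : dprod) : dprod :=
  fun l => if l is l'.+1 then t l' (x l') else 0.

(* x = \sum_l (in_l (u l) - in_(l+1) (t l (u l))) for some u in the direct sum *)
Definition rel_pred : {pred dsum} :=
  fun x => `[< exists u : dsum,
    forall l, dsum_val x l = dsum_val u l - shift (dsum_val u) l >].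

Fact rel_pred_closed : submod_closed rel_pred.
Proof.
split=> [|a x y]; rewrite !unfold_in.
  apply/asboolP; exists 0 => -[|l]; first by rewrite subr0.
  by change (0 = 0 - t l 0); rewrite linear0 subr0.
move=> /asboolP[u xu] /asboolP[w yw]; apply/asboolP; exists (a *: u + w) => l.
change (a *: dsum_val x l + dsum_val y l =
  (a *: dsum_val u l + dsum_val w l) - shift (dsum_val (a *: u + w)) l).
rewrite xu yw; case: l => [|l] /=; first by rewrite !subr0.
change (a *: (dsum_val u l.+1 - t l (dsum_val u l)) +
    (dsum_val w l.+1 - t l (dsum_val w l)) =
  a *: dsum_val u l.+1 + dsum_val w l.+1 -
    t l (a *: dsum_val u l + dsum_val w l)).
by rewrite linearP scalerBr opprD addrACA.
Qed.

HB.instance Definition _ := GRing.isSubmodClosed.Build R dsum rel_pred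
  rel_pred_closed.

Definition dirlim : lmodType R := quotmod rel_pred.

Definition to_dirlim l (x : E l) : dirlim := qclass rel_pred (indsum x).

Fact to_dirlim_is_linear l : linear (@to_dirlim l).
Proof.
move=> a x y; rewrite /to_dirlim -linearP; congr qclass.
apply: val_inj; apply: functional_extensionality_dep => m.
change (inprod (a *: x + y) m = a *: inprod x m + inprod y m).
rewrite /inprod; have [<-|lm] := eqVneq l m; first by rewrite !dfwith_in.
by rewrite !dfwith_out // scaler0 addr0.
Qed.

Definition dirlim_map l : {linear E l -> dirlim} :=
  HB.pack (@to_dirlim l) (GRing.isLinear.Build R (E l) dirlim _
    (@to_dirlim l) (@to_dirlim_is_linear l)).

Lemma dirlim_map_compat l (x : E l) : dirlim_map l.+1 (t l x) = dirlim_map l x.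
Proof.
apply/esym/qclassP; rewrite unfold_in; apply/asboolP; exists (indsum x) => m.
change (inprod x m - inprod (t l x) m = inprod x m - shift (inprod x) m).
congr (_ - _); rewrite /inprod; case: m => [|m] /=; first by rewrite dfwith_out.
have [<-|lm] := eqVneq l m; first by rewrite !dfwith_in.
by rewrite !dfwith_out ?linear0.
Qed.

End DirectLimit.

Section Ext.
Variables (k : fieldType) (n : nat).
Local Notation S := {mpoly k[n]}.

Definition expvec (m : 'X_{1..n}) : 'rV[int]_n := \row_j (m j)%:Z.

Definition homogeneous (p : 'rV[int]_n) (f : S) : Prop :=
  forall m, m \in msupp f -> expvec m = p.

Definition ideal_gen (G : S -> Prop) (f : S) : Prop :=
  exists r (c g : 'I_r -> S), (forall s, G (g s)) /\ f = \sum_s c s * g s.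

Definition squarefree (m : 'X_{1..n}) : Prop := forall j, (m j <= 1)%N.

Definition squarefree_monomial_ideal (B : S -> Prop) : Prop :=
  exists G : 'X_{1..n} -> Prop, (forall m, G m -> squarefree m) /\
    forall f, B f <-> ideal_gen (fun g => exists2 m, G m & g = 'X_[m]) f.

Definition monomial_power (B : S -> Prop) (l : nat) : S -> Prop :=
  ideal_gen (fun g => exists2 m : 'X_{1..n}, B 'X_[m] & g = 'X_[m] ^+ l).

(* A Z^n-graded resolution of S/J by free modules of finite rank.  The m-th
   module is the module of row vectors 'rV[S]_(res_rank m), whose j-th basis vector
   has degree gdeg m j, and matrices act on row vectors on the right.  The
   augmentation sends u to the class of u *m aug in S/J.  Ext and local
   cohomology below are computed from an arbitrary choice of such resolutions,
   on which they do not depend up to canonical isomorphism. *)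
Record resolution (J : S -> Prop) := Resolution {
  res_rank : nat -> nat;
  gdeg : forall m, 'I_(res_rank m) -> 'rV[int]_n;
  res_diff : forall m, 'M[S]_(res_rank m.+1, res_rank m);
  aug : 'cV[S]_(res_rank 0);
  diff_homogeneous : forall m i j,
    homogeneous (gdeg i - gdeg j) (res_diff m i j);
  aug_homogeneous : forall i, homogeneous (gdeg i) (aug i 0);
  aug_surjective : forall f, exists u : 'rV[S]_(res_rank 0), J (f - (u *m aug) 0 0);
  exact_at_0 : forall u : 'rV[S]_(res_rank 0),
    J ((u *m aug) 0 0) <-> exists v, u = v *m res_diff 0;
  exact_at_S : forall m (u : 'rV[S]_(res_rank m.+1)),
    u *m res_diff m = 0 <-> exists v, u = v *m res_diff m.+1
}.

(* A degree 0 chain map lifting the natural surjection S/J -> S/J', where J is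
   contained in J'. *)
Record reslift (J J' : S -> Prop) (F : resolution J) (F' : resolution J') := Reslift {
  reslift_map : forall m, 'M[S]_(res_rank F m, res_rank F' m);
  reslift_homogeneous : forall m i j,
    homogeneous (gdeg (r := F) i - gdeg (r := F') j) (reslift_map m i j);
  reslift_diff : forall m,
    res_diff F m *m reslift_map m = reslift_map m.+1 *m res_diff F' m;
  reslift_aug : forall i, J' ((aug F - reslift_map 0 *m aug F') i 0)
}.

Section ExtModule.
Variables (J : S -> Prop) (F : resolution J).

(* A column vector z is the S-linear map u |-> u *m z, so that
   Hom_S(F_m, S) = 'cV[S]_(res_rank F m), with differential z |-> res_diff F m *m z.
   The incoming differential in cohomological degree 0 starts at the zero
   module 'cV[S]_0. *)
Definition prerank (i : nat) : nat := if i is i'.+1 then res_rank F i' else 0%N.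

Definition prediff (i : nat) : 'M[S]_(res_rank F i, prerank i) :=
  if i is i'.+1 then res_diff F i' else 0.

Definition codiff_in (i : nat) : {linear 'cV[S]_(prerank i) -> 'cV[S]_(res_rank F i)} :=
  mulmx (prediff i).

Definition codiff (i : nat) : {linear 'cV[S]_(res_rank F i) -> 'cV[S]_(res_rank F i.+1)} :=
  mulmx (res_diff F i).

Definition Ext (i : nat) : lmodType S := homology (codiff_in i) (codiff i).

(* The graded piece Ext^i_S(S/J, S)_p: a homomorphism of degree p maps a basis
   vector of degree a into S_(a + p). *)
Definition Ext_piece (i : nat) (p : 'rV[int]_n) (x : Ext i) : Prop :=
  exists2 z : cycles (codiff i),
    forall j, homogeneous (gdeg j + p) (cycle_val z j 0) & x = hclass (codiff_in i) z.

End ExtModule.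

Section ExtMap.
Variables (J J' : S -> Prop) (F : resolution J) (F' : resolution J').
Variables (c : reslift F F') (i : nat).

Definition colift : {linear 'cV[S]_(res_rank F' i) -> 'cV[S]_(res_rank F i)} :=
  mulmx (reslift_map c i).

Fact colift_cycle z : codiff F' i z = 0 -> codiff F i (colift z) = 0.
Proof.
rewrite /codiff /colift /= => z0.
by rewrite mulmxA reslift_diff -mulmxA z0 mulmx0.
Qed.

Fact colift_boundary x :
  exists y, colift (codiff_in F' i x) = codiff_in F i y.
Proof.
rewrite /colift /codiff_in /=; case: i x => [|i'] x /=.
  by exists 0; rewrite !mul0mx mulmx0.
by exists (reslift_map c i' *m x); rewrite !mulmxA reslift_diff.
Qed.

Definition Ext_map : {linear Ext F' i -> Ext F i} :=
  homology_linear colift_cycle colift_boundary.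

End ExtMap.

Section LocalCohomology.
Variables (B : S -> Prop).
Variables (F : forall l, resolution (monomial_power B l)).
Variables (c : forall l, reslift (F l.+1) (F l)).
Variable (i : nat).

Definition local_cohomology : lmodType S :=
  dirlim (fun l => Ext_map (c l) i).

Definition Ext_to_lc (l : nat) : {linear Ext (F l) i -> local_cohomology} :=
  dirlim_map (fun l => Ext_map (c l) i) l.

Definition lc_piece (p : 'rV[int]_n) (y : local_cohomology) : Prop :=
  exists l, exists2 x, Ext_piece p x & y = Ext_to_lc l x.

End LocalCohomology.

(* N_delta, the sum of the N_p for p in the fibre of phi over delta, for the
   grading of N whose homogeneous elements of degree p are given by [piece p]. *)
Definition coarse_piece (D : zmodType) (phi : {additive 'rV[int]_n -> D})
    (N : zmodType) (piece : 'rV[int]_n -> N -> Prop) (delta : D) (x : N) : Prop :=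
  exists r (p : 'I_r -> 'rV[int]_n) (y : 'I_r -> N),
    (forall s, phi (p s) = delta /\ piece (p s) (y s)) /\ x = \sum_s y s.

(* P is a k-subspace of an S-module; scalars act through constant polynomials. *)
Definition finite_dimensional (N : lmodType S) (P : N -> Prop) : Prop :=
  exists r (b : 'I_r -> N), (forall s, P (b s)) /\
    forall x, P x -> exists a : 'I_r -> k, x = \sum_s (a s)%:MP *: b s.

End Ext.

Section Regions.
Variable n : nat.

Definition neg_set (p : 'rV[int]_n) : {set 'I_n} := [set j | p 0 j < 0].

Definition L_ (I : {set 'I_n}) (p : 'rV[int]_n) : Prop := neg_set p = I.

Definition C_ (I : {set 'I_n}) (p : 'rV[int]_n) : Prop :=
  forall j, if j \in I then p 0 j <= 0 else 0 <= p 0 j.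

Definition p_ (I : {set 'I_n}) : 'rV[int]_n :=
  \row_j (if j \in I then -1 else 0).

Definition slice (M : zmodType) (rho : {additive M -> 'rV[int]_n})
    (I : {set 'I_n}) (p q : 'rV[int]_n) : Prop :=
  (exists x, q = p + rho x) /\ (exists2 v, C_ I v & q = p_ I + v).

Definition coord_min (P : 'rV[int]_n -> Prop) (j : 'I_n) (a : int) : Prop :=
  (exists2 q, P q & q 0 j = a) /\ (forall q, P q -> a <= q 0 j).

(* The default value 0 of [xget] is taken when there is no minimum, in
   particular when the set is empty. *)
Definition f_ (M : zmodType) (rho : {additive M -> 'rV[int]_n})
    (I : {set 'I_n}) (j : 'I_n) (p : 'rV[int]_n) : nat :=
  xget 0%N [set v : nat |
    exists2 a, coord_min (slice rho I p) j a & v%:Z = Num.max 0 (- a)].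

Definition polyhedron (R : realFieldType) (m : nat) (A : 'M[R]_(n, m))
    (b : 'rV[R]_m) (x : 'rV[R]_n) : Prop :=
  forall s, (x *m A) 0 s <= b 0 s.

Definition in_bounded_polyhedron (R : realFieldType) (P : 'rV[int]_n -> Prop) : Prop :=
  exists m (A : 'M[R]_(n, m)) (b : 'rV[R]_m),
    (exists a, forall x, polyhedron A b x -> forall j, `|x 0 j| <= a) /\
    (forall q, P q -> polyhedron A b (map_mx intr q)).

End Regions.

Section Comparison.
Variables (k : fieldType) (n : nat) (B : {mpoly k[n]} -> Prop).
Variables (F : forall l, resolution (monomial_power B l)).
Variables (c : forall l, reslift (F l.+1) (F l)).
Variable (i : nat).

Definition Sigma (I : {set 'I_n}) : Prop :=
  forall p, L_ I p -> exists2 y, lc_piece (c := c) (i := i) p y & y <> 0.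

Definition Ext_eq_lc (D : zmodType) (phi : {additive 'rV[int]_n -> D})
    (delta : D) (l : nat) : Prop :=
  let ExtD := coarse_piece phi (@Ext_piece _ _ _ (F l) i) delta in
  let lcD := coarse_piece phi (@lc_piece _ _ _ F c i) delta in
  (forall x x', ExtD x -> ExtD x' -> Ext_to_lc c i l x = Ext_to_lc c i l x' -> x = x') /\
  (forall y, lcD y -> exists2 x, ExtD x & Ext_to_lc c i l x = y).

Definition f_max (M : zmodType) (rho : {additive M -> 'rV[int]_n})
    (p : 'rV[int]_n) : nat :=
  \max_(I : {set 'I_n} | `[< Sigma I >]) \max_(j in I) f_ rho I j p.

End Comparison.

(* Main.v *)
Require Import Defs.
From HB Require Import structures.
From mathcomp Require Import all_boot all_order all_algebra.
From mathcomp Require Import mpoly zify.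
From mathcomp Require boolp classical_sets.
Import Order.TTheory GRing.Theory Num.Theory.
Local Open Scope ring_scope.

Set Implicit Arguments.
Unset Strict Implicit.
Unset Printing Implicit Defensive.

(** The theorem rests on a description of the natural map
    [Ext^i(S/B^[l], S)_p -> H^i_B(S)_p] in every degree [p] of [Z^n]: it is an
    isomorphism if all entries of [p] are at least [-l], and its source is zero
    otherwise. In particular the natural map is always injective, and in degree
    [delta] of [D] it is onto if and only if [H^i_B(S)_p = 0] for all [p] over
    [delta] that have an entry below [-l]. As [H^i_B(S)_p] is nonzero exactly
    when the set [I] of negative entries of [p] lies in [Sigma_i], this says that
    the points of [(p + M)] in [p_I + C_I = L_I], for [I] in [Sigma_i], have all
    entries at least [-l], which is the inequality between [l] and the
    [f_(I,j)(delta)]. The minimum in the definition of [f_(I,j)] exists because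
    these points form a finite set: each of them contributes a nonzero summand
    to the finite dimensional space [H^i_B(S)_delta] ([slice_bounded]).

    The degreewise description has to be obtained from arbitrary graded free
    resolutions. The entries of a homogeneous matrix are scalars times monomials
    determined by the degrees of the basis vectors, so a graded free complex is
    the same as a complex of matrices over [k] whose basis vectors carry degrees,
    and a basis vector only maps to basis vectors of smaller or equal degree. The
    complex [Hom(F, S)_p] is then the [k]-dual of the quotient of this complex
    spanned by the basis vectors of degree at least [-p]. The basis vectors of
    degree at most [q] span a subcomplex, which is the graded piece [F_q]; its
    homology is [(S/J)_q]. Removing the basis vectors that violate the condition
    [-p <= deg] one coordinate at a time gives short exact sequences, and two out
    of three in these sequences turns exactness of the pieces of degree [q], for
    the [q] all of whose entries are [-p_j - 1] or very large, into exactness of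
    [Hom(F, S)_p] ([exact_upset], [exact_dual]).

    This is applied to the mapping cone of a map of resolutions, whose piece of
    degree [q] is exact as soon as [S/J] and [S/J'] are both zero or both nonzero
    in degree [q] ([cone_exact_at]). So [Ext(S/J', S)_p -> Ext(S/J, S)_p] is
    bijective if [S/J] and [S/J'] agree in the degrees [q] above
    ([cohomology_inj], [cohomology_onto]). Since [B] has square-free generators,
    whether [S/B^[l]] vanishes in degree [q] only depends on which entries of [q]
    are negative and which are at least [l] ([standard_class]). Comparing [S/B^[l]]
    and [S/B^[l+1]] gives the bijectivity of the transition maps for [p >= -l];
    comparing [S/B^[l]] with its twist by a monomial [x^e] shows that
    multiplication by [x^e] is bijective between degrees that are at least [-l] and
    have the same negative entries, and that [Ext_p] with [p_j < -l] is isomorphic to [Ext_(p - N e_j)]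
    for all [N], hence zero ([Ext_piece_low]). *)

(** * Homogeneous components of polynomials *)

Section Degrees.
Variable n : nat.
Implicit Types p q a b : 'rV[int]_n.

Lemma row0E (j : 'I_n) : (0%R : 'rV[int]_n) 0%R j = 0%R.
Proof. exact: mxE. Qed.

Lemma rowDE p q (j : 'I_n) : (p + q) 0 j = (p 0%R j + q 0%R j)%R.
Proof. exact: mxE. Qed.

Lemma rowNE p (j : 'I_n) : (- p) 0 j = (- p 0%R j)%R.
Proof. exact: mxE. Qed.

Definition coordE := (row0E, rowDE, rowNE).

Definition dle p q : bool := [forall j, p 0 j <= q 0 j].

Lemma dleP p q : reflect (forall j, p 0 j <= q 0 j) (dle p q).
Proof. exact: forallP. Qed.

Lemma dle_trans q p a : dle p q -> dle q a -> dle p a.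
Proof. by move=> /dleP pq /dleP qa; apply/dleP => j; apply: le_trans (qa j). Qed.

Lemma dle_sub p q a : dle p q -> dle (p - a) (q - a).
Proof.
by move=> /dleP pq; apply/dleP => j; move: (pq j); rewrite !mxE lerD2r.
Qed.

Lemma dle0B p q : dle 0 (q - p) = dle p q.
Proof. by apply: eq_forallb => j; rewrite !mxE subr_ge0. Qed.

Lemma dle0D p q : dle 0 p -> dle 0 q -> dle 0 (p + q).
Proof.
by move=> /dleP p0 /dleP q0; apply/dleP => j; move: (p0 j) (q0 j); rewrite !coordE; lia.
Qed.

Definition xmon p : 'X_{1..n} := [multinom `|p 0%R j|%N | j < n].

Lemma expvec_xmon p : dle 0 p -> expvec (xmon p) = p.
Proof.
move=> /dleP p0; apply/rowP => j; rewrite mxE mnmE.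
by have := p0 j; rewrite mxE; lia.
Qed.

Lemma xmon_expvec (m : 'X_{1..n}) : xmon (expvec m) = m.
Proof. by apply/mnmP => j; rewrite mnmE mxE absz_nat. Qed.

Lemma expvec_inj : injective (@expvec n).
Proof. exact: can_inj xmon_expvec. Qed.

Lemma expvec_ge0 (m : 'X_{1..n}) : dle 0 (expvec m).
Proof. by apply/dleP => j; rewrite !mxE. Qed.

Lemma expvecD (m m' : 'X_{1..n}) : expvec (m + m')%MM = expvec m + expvec m'.
Proof. by apply/rowP => j; rewrite !mxE mnmDE. Qed.

Lemma xmonD p q : dle 0 p -> dle 0 q -> xmon (p + q) = (xmon p + xmon q)%MM.
Proof.
by move=> p0 q0; apply: expvec_inj; rewrite expvecD !expvec_xmon // dle0D.
Qed.

End Degrees.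

Section Scalars.
Variables (k : fieldType) (n : nat).
Local Notation S := {mpoly k[n]}.
Implicit Types (p q a b : 'rV[int]_n) (f g : S).

(** [x^p], extended by zero to the degrees in which [S] is zero. *)
Definition xpow p : S := if dle 0 p then 'X_[xmon p] else 0.

(** The coefficient of [f] at [x^p], zero if [p] has a negative entry. *)
Definition scal p f : k := if dle 0 p then f@_(xmon p) else 0.

Fact scal_is_additive p : additive (scal p).
Proof. by move=> f g; rewrite /scal; case: ifP; rewrite ?subr0 // mcoeffB. Qed.

HB.instance Definition _ p := GRing.isZmodMorphism.Build S k (scal p)
  (scal_is_additive p).

Lemma scalZ p c f : scal p (c *: f) = c * scal p f.
Proof. by rewrite /scal; case: ifP; rewrite ?mulr0 // mcoeffZ. Qed.

Lemma scal_ge0 p f : scal p f != 0 -> dle 0 p.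
Proof. by rewrite /scal; case: ifP => //; rewrite eqxx. Qed.

Lemma scal_expvec f (m : 'X_{1..n}) : scal (expvec m) f = f@_m.
Proof. by rewrite /scal expvec_ge0 xmon_expvec. Qed.

Lemma scal_xpow p q : scal p (xpow q) = ((p == q) && dle 0 p)%:R.
Proof.
rewrite /scal /xpow; case: (boolP (dle 0 p)) => p0; last by rewrite andbF.
case: (boolP (dle 0 q)) => q0; last first.
  by rewrite mcoeff0 andbT; case: eqP => // pq; rewrite -pq p0 in q0.
rewrite mcoeffX andbT eq_sym; congr (nat_of_bool _)%:R.
apply/eqP/eqP => [/(congr1 (@expvec n))|->//].
by rewrite !expvec_xmon.
Qed.

Lemma homogeneousP p f : homogeneous p f <-> f = scal p f *: xpow p.
Proof.
split=> [hf|->].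
  apply/mpolyP => m; rewrite mcoeffZ /scal /xpow.
  have [mf|mf] := boolP (m \in msupp f).
    rewrite -(hf m mf) expvec_ge0 xmon_expvec mcoeffX eqxx mulr1 //.
  have f0 : f@_m = 0 by apply/eqP; rewrite mcoeff_eq0.
  rewrite f0; case: ifP => p0; last by rewrite mul0r.
  by rewrite mcoeffX; case: eqP => [->|_]; rewrite ?f0 ?mul0r ?mulr0.
move=> m; rewrite mcoeff_msupp mcoeffZ /xpow; case: ifP => p0; last first.
  by rewrite mcoeff0 mulr0 eqxx.
rewrite mcoeffX; case: (xmon p =P m) => [<- _|]; first exact: expvec_xmon.
by rewrite mulr0 eqxx.
Qed.

Lemma homogeneousZx p c : homogeneous p (c *: xpow p).
Proof.
apply/homogeneousP; rewrite scalZ scal_xpow eqxx /=.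
by have [p0|/negbTE p0] := boolP (dle 0 p); rewrite ?mulr1 // /xpow p0 !scaler0.
Qed.

Lemma scal_homogeneous p q f : homogeneous p f -> p != q -> scal q f = 0.
Proof.
move=> /homogeneousP -> pq; rewrite scalZ scal_xpow eq_sym (negbTE pq) mulr0 //.
Qed.

Lemma xpowD p q : dle 0 p -> dle 0 q -> xpow p * xpow q = xpow (p + q).
Proof.
move=> p0 q0; by rewrite /xpow p0 q0 xmonD // mpolyXD dle0D.
Qed.

(** Multiplication by a homogeneous polynomial acts on the homogeneous
    components of the other factor one degree at a time: a monomial of [f * g]
    of degree [a + b] can only come from the monomial of degree [b] of [g], also
    when [b] has negative entries and there is no such monomial. *)
Lemma scalM a b f g : homogeneous a f -> scal (a + b) (f * g) = scal a f * scal b g.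
Proof.
move=> /homogeneousP hf; have [a0|a0] := boolP (dle 0 a); last first.
  by rewrite hf /xpow (negbTE a0) scaler0 mul0r raddf0 /scal (negbTE a0) mul0r.
rewrite {1}hf -scalerAl scalZ; congr (_ * _).
rewrite /xpow a0 mulrC; have [b0|b0] := boolP (dle 0 b).
  by rewrite /scal b0 dle0D // xmonD // mcoeffMX.
rewrite /(scal b) (negbTE b0) /scal; case: ifP => // ab0.
apply: contraNeq b0; rewrite -mcoeff_msupp (perm_mem (msuppMX _ _)) => /mapP[m _ abE].
have -> : b = expvec m; last exact: expvec_ge0.
apply: (addrI a); rewrite -(expvec_xmon ab0) abE expvecD expvec_xmon //.
Qed.

Lemma scalMr a b f g : homogeneous a f -> scal (b + a) (g * f) = scal b g * scal a f.
Proof. by move=> hf; rewrite addrC mulrC scalM // mulrC. Qed.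

(** The degrees are written [d + p] because the entries of a vector over a graded free
    module are read off with a shift depending on the entry. *)
Lemma scal_decomp (Ps : seq 'rV[int]_n) d f : uniq Ps ->
  (forall m, m \in msupp f -> expvec m - d \in Ps) ->
  f = \sum_(p <- Ps) scal (d + p) f *: xpow (d + p).
Proof.
move=> uPs hPs; apply/mpolyP => m; rewrite raddf_sum /=.
have termE p : (scal (d + p) f *: xpow (d + p))@_m =
    if p == expvec m - d then f@_m else 0.
  rewrite mcoeffZ -[in LHS]scal_expvec scal_xpow expvec_ge0 andbT.
  have -> : (expvec m == d + p) = (p == expvec m - d).
    by apply/eqP/eqP => ->; [rewrite addrC addKr | rewrite addrC subrK].
  by case: eqP => [->|_]; rewrite ?mulr0 // addrC subrK scal_expvec mulr1.
rewrite (eq_bigr _ (fun p _ => termE p)).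
have [mf|mf] := boolP (m \in msupp f); last first.
  have -> : f@_m = 0 by apply/eqP; rewrite mcoeff_eq0.
  by rewrite big1 // => p _; case: ifP.
rewrite (bigD1_seq _ (hPs m mf)) //= eqxx big1 ?addr0 // => p.
by move/negbTE ->.
Qed.

End Scalars.

(** * Graded free complexes as complexes of scalar matrices *)
Section Masks.
Variables (k : fieldType) (n : nat).
Implicit Types (P U : pred 'rV[int]_n).

Definition supp r (d : 'I_r -> 'rV[int]_n) P (u : 'rV[k]_r) : Prop :=
  forall j, u 0 j != 0 -> P (d j).

Definition csupp r (d : 'I_r -> 'rV[int]_n) P (z : 'cV[k]_r) : Prop :=
  forall j, z j 0 != 0 -> P (d j).

(** The projection onto the span of the basis vectors with degree in [P]. *)
Definition maskmx r (d : 'I_r -> 'rV[int]_n) P : 'M[k]_r :=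
  diag_mx (\row_j (P (d j))%:R).

(** The condition on the scalars of a homogeneous matrix: the entry from a basis
    vector of degree [a] to one of degree [b] multiplies [x^(a - b)]. *)
Definition lower r s (d : 'I_r -> 'rV[int]_n) (d' : 'I_s -> 'rV[int]_n)
  (A : 'M[k]_(r, s)) : Prop := forall i j, A i j != 0 -> dle (d' j) (d i).

Definition downset P : Prop := forall p q, dle p q -> P q -> P p.

Definition convex P : Prop :=
  forall p q a, dle p q -> dle q a -> P p -> P a -> P q.

Lemma mul_maskE r m (d : 'I_r -> 'rV[int]_n) P (u : 'M[k]_(m, r)) i j :
  (u *m maskmx d P) i j = if P (d j) then u i j else 0.
Proof. by rewrite mul_mx_diag !mxE; case: ifP; rewrite ?mulr1 ?mulr0. Qed.

Lemma mask_mulE r m (d : 'I_r -> 'rV[int]_n) P (u : 'M[k]_(r, m)) i j :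
  (maskmx d P *m u) i j = if P (d i) then u i j else 0.
Proof. by rewrite mul_diag_mx !mxE; case: ifP; rewrite ?mul1r ?mul0r. Qed.

Lemma maskI r (d : 'I_r -> 'rV[int]_n) P U :
  maskmx d P *m maskmx d U = maskmx d (predI P U).
Proof.
rewrite /maskmx mulmx_diag; congr diag_mx; apply/rowP => j; rewrite !mxE /=.
by case: (P _); rewrite ?mul1r ?mul0r.
Qed.

Lemma eq_mask r (d : 'I_r -> 'rV[int]_n) P U : P =1 U -> maskmx d P = maskmx d U.
Proof. by move=> PU; congr diag_mx; apply/rowP => j; rewrite !mxE PU. Qed.

Lemma maskC r (d : 'I_r -> 'rV[int]_n) P :
  maskmx d (predC P) = 1%:M - maskmx d P.
Proof.
apply/matrixP => i j; rewrite !mxE /=.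
by case: eqP => [->|_]; rewrite ?subr0 ?mulr0n //; case: (P _); rewrite ?subrr ?subr0.
Qed.

Lemma supp_mask r (d : 'I_r -> 'rV[int]_n) P (u : 'rV[k]_r) :
  supp d P u -> u *m maskmx d P = u.
Proof.
move=> su; apply/rowP => j; rewrite mul_maskE; case: ifP => // /negbT Pj.
by apply/esym/eqP; apply: contraNT Pj; apply: su.
Qed.

Lemma mask_supp r (d : 'I_r -> 'rV[int]_n) P U (u : 'rV[k]_r) :
  supp d P u -> supp d (predI P U) (u *m maskmx d U).
Proof.
move=> su j; rewrite mul_maskE /=; case: ifP => [Uj /su Pj|]; last by rewrite eqxx.
by rewrite Pj.
Qed.

Lemma supp_mask0 r (d : 'I_r -> 'rV[int]_n) P U (u : 'rV[k]_r) :
  supp d (predI P (predC U)) u -> u *m maskmx d U = 0.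
Proof.
move=> su; apply/rowP => j; rewrite mul_maskE mxE; case: ifP => // Uj.
by apply/eqP; apply: contraTT Uj => /su /andP[].
Qed.

Lemma csupp_mask r (d : 'I_r -> 'rV[int]_n) P (z : 'cV[k]_r) :
  csupp d P z -> maskmx d P *m z = z.
Proof.
move=> su; apply/colP => j; rewrite mask_mulE; case: ifP => // /negbT Pj.
by apply/esym/eqP; apply: contraNT Pj; apply: su.
Qed.

Lemma mask_csupp r (d : 'I_r -> 'rV[int]_n) P (z : 'cV[k]_r) :
  csupp d P (maskmx d P *m z).
Proof. by move=> j; rewrite mask_mulE; case: ifP; rewrite ?eqxx. Qed.

Lemma suppD r (d : 'I_r -> 'rV[int]_n) P (u v : 'rV[k]_r) :
  supp d P u -> supp d P v -> supp d P (u + v).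
Proof.
move=> su sv j; rewrite mxE; have [u0|/su-> //] := eqVneq (u 0 j) 0.
by rewrite u0 add0r => /sv.
Qed.

Lemma suppN r (d : 'I_r -> 'rV[int]_n) P (u : 'rV[k]_r) :
  supp d P u -> supp d P (- u).
Proof. by move=> su j; rewrite mxE oppr_eq0 => /su. Qed.

Lemma csuppD r (d : 'I_r -> 'rV[int]_n) P (u v : 'cV[k]_r) :
  csupp d P u -> csupp d P v -> csupp d P (u + v).
Proof.
move=> su sv j; rewrite mxE; have [u0|/su-> //] := eqVneq (u j 0) 0.
by rewrite u0 add0r => /sv.
Qed.

Lemma csuppN r (d : 'I_r -> 'rV[int]_n) P (u : 'cV[k]_r) :
  csupp d P u -> csupp d P (- u).
Proof. by move=> su j; rewrite mxE oppr_eq0 => /su. Qed.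

Lemma sub_supp r (d : 'I_r -> 'rV[int]_n) P U (u : 'rV[k]_r) :
  (forall p, P p -> U p) -> supp d P u -> supp d U u.
Proof. by move=> PU su j /su/PU. Qed.

Lemma lower_supp r s (d : 'I_r -> 'rV[int]_n) (d' : 'I_s -> 'rV[int]_n) A P u :
  lower d d' A -> downset P -> supp d P u -> supp d' P (u *m A).
Proof.
move=> lA dP su j; rewrite mxE; apply: contraR => Pj.
rewrite big1 // => i _; have [->|/su Pi] := eqVneq (u 0 i) 0; first by rewrite mul0r.
have [->|/lA/dP/(_ Pi)] := eqVneq (A i j) 0; first by rewrite mulr0.
by rewrite (negbTE Pj).
Qed.

Lemma lower_csupp r s (d : 'I_r -> 'rV[int]_n) (d' : 'I_s -> 'rV[int]_n) A b z :
  lower d d' A -> csupp d' (dle b) z -> csupp d (dle b) (A *m z).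
Proof.
move=> lA su i; rewrite mxE; apply: contraR => Pi.
rewrite big1 // => j _; have [->|/su Pj] := eqVneq (z j 0) 0; first by rewrite mulr0.
have [->|/lA/(dle_trans Pj)] := eqVneq (A i j) 0; first by rewrite mul0r.
by rewrite (negbTE Pi).
Qed.

Lemma mask_down r s (d : 'I_r -> 'rV[int]_n) (d' : 'I_s -> 'rV[int]_n) A P :
  lower d d' A -> downset P -> maskmx d P *m A = maskmx d P *m A *m maskmx d' P.
Proof.
move=> lA dP; apply/matrixP => i j; rewrite mul_maskE mask_mulE.
case: (boolP (P (d' j))) => // Pj; case: ifP => // Pi.
by apply/eqP; apply: contraNT Pj => /lA/dP; apply.
Qed.

(** On the span of the basis vectors with degree in a convex set, the composite of
    the restricted maps is the restriction of the composite, as all intermediate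
    degrees lie in that set. *)
Lemma mask_convex r s t (d : 'I_r -> 'rV[int]_n) (d' : 'I_s -> 'rV[int]_n)
  (d'' : 'I_t -> 'rV[int]_n) A A' P :
  lower d d' A -> lower d' d'' A' -> convex P ->
  maskmx d P *m A *m maskmx d' P *m A' *m maskmx d'' P =
  maskmx d P *m A *m A' *m maskmx d'' P.
Proof.
move=> lA lA' cP; apply/matrixP => i j; rewrite !mul_maskE.
case: ifP => // Pj; rewrite !mxE; apply: eq_bigr => l _.
rewrite mul_maskE !mask_mulE; case: (boolP (P (d i))) => [Pi|_]; last first.
  by case: ifP; rewrite mul0r.
have [->|Ail] := eqVneq (A i l) 0; first by case: ifP.
have [->|A'lj] := eqVneq (A' l j) 0; first by rewrite !mulr0.
by rewrite (cP _ _ _ (lA' _ _ A'lj) (lA _ _ Ail) Pj Pi).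
Qed.

End Masks.

Section Complexes.
Variables (k : fieldType) (n : nat).
Implicit Types (P U : pred 'rV[int]_n) (p q b : 'rV[int]_n).

(** The scalars of a complex of graded free modules of finite rank over [S]. The
    graded piece of degree [q] of the complex is the subcomplex spanned by the
    basis vectors of degree at most [q]. *)
Record gcomplex := GComplex {
  rk : nat -> nat;
  deg : forall m, 'I_(rk m) -> 'rV[int]_n;
  dif : forall m, 'M[k]_(rk m.+1, rk m);
  dif_le : forall m, lower (@deg m.+1) (@deg m) (dif m);
  dif_comp : forall m, dif m.+1 *m dif m = 0
}.

(* The complex is continued by zero on the right, so that the map out of stage [i]
   is defined for all [i]. *)
Definition prk (K : gcomplex) (i : nat) : nat := if i is i'.+1 then rk K i' else 0%N.

Definition pdeg (K : gcomplex) (i : nat) : 'I_(prk K i) -> 'rV[int]_n :=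
  match i with 0%N => fun=> 0 | i'.+1 => @deg K i' end.

Definition pdif (K : gcomplex) (i : nat) : 'M[k]_(rk K i, prk K i) :=
  match i with 0%N => 0 | i'.+1 => dif K i' end.

Lemma pdif_le K i : lower (@deg K i) (@pdeg K i) (pdif K i).
Proof. by case: i => [|i]; [move=> ? [] | apply: dif_le]. Qed.

Lemma pdif_comp K i : dif K i *m pdif K i = 0.
Proof. by case: i => [|i]; [rewrite [LHS]thinmx0 [RHS]thinmx0 | apply: dif_comp]. Qed.

(** Exactness at stage [i] of the subquotient spanned by the basis vectors with
    degree in [P], for [P] convex. *)
Definition exact_on (K : gcomplex) P (i : nat) : Prop :=
  forall u : 'rV[k]_(rk K i), supp (@deg K i) P u ->
    u *m pdif K i *m maskmx k (@pdeg K i) P = 0 ->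
  exists2 v, supp (@deg K i.+1) P v & u = v *m dif K i *m maskmx k (@deg K i) P.

(** Two out of three for the short exact sequence of subquotients
    [0 -> P /\ U -> P -> P /\ ~ U -> 0] of a complex. *)
Lemma exact_quotient K P U : convex P -> downset U ->
  (forall i, exact_on K (predI P U) i) -> (forall i, exact_on K P i) ->
  forall i, exact_on K (predI P (predC U)) i.
Proof.
move=> cP dU exPU exP i u su uA.
have suP : supp (@deg K i) P u by apply: sub_supp su => p /andP[].
(* After subtracting an element [u'] of the subcomplex, [u] is a cycle of the
   subquotient on [P]. *)
have [u' su' uA'] : exists2 u', supp (@deg K i) (predI P U) u' &
    (u - u') *m pdif K i *m maskmx k (@pdeg K i) P = 0.
  case: i u su uA suP => [|i] u su uA suP.
    exists 0; last by rewrite [LHS]thinmx0 [RHS]thinmx0.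
    by move=> j; rewrite mxE eqxx.
  set w := u *m dif K i *m maskmx k (@deg K i) P.
  have sw : supp (@deg K i) (predI P U) w.
    move=> j; rewrite mul_maskE /=; case: ifP => [Pj|]; last by rewrite eqxx.
    case: (boolP (U _)) => // Uj /eqP[]; move/rowP/(_ j): uA.
    by rewrite [RHS]mxE mul_maskE /= Pj Uj.
  have wA : w *m pdif K i *m maskmx k (@pdeg K i) P = 0.
    have := congr1 (mulmx u) (mask_convex (@dif_le K i) (@pdif_le K i) cP).
    rewrite !mulmxA (supp_mask suP) => ->.
    by rewrite -(mulmxA u) pdif_comp mulmx0 mul0mx.
  have [|u' su' wE] := exPU i w sw; first by rewrite -maskI mulmxA wA mul0mx.
  exists u' => //; rewrite !mulmxBl -/w [X in w - X](_ : _ = w) ?subrr //.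
  have /supp_mask <- : supp (@deg K i.+1) U u' by apply: sub_supp su' => p /andP[].
  rewrite -[pdif _ _]/(dif K i) -(mulmxA u') (mask_down (@dif_le K i) dU).
  rewrite !mulmxA -[_ *m maskmx _ _ P]mulmxA maskI supp_mask; last first.
    by apply: sub_supp su' => p /andP[].
  by rewrite [RHS]wE; congr (_ *m _); apply: eq_mask => p /=; rewrite andbC.
have su'P : supp (@deg K i) P u' by apply: sub_supp su' => p /andP[].
have [v sv uE] := exP i (u - u') (suppD suP (suppN su'P)) uA'.
exists (v *m maskmx k (@deg K i.+1) (predC U)); first exact: mask_supp.
have vN : v *m maskmx k (@deg K i.+1) U *m dif K i *m maskmx k (@deg K i) (predC U) = 0.
  rewrite -!mulmxA (mulmxA (maskmx _ _ U)) (mask_down (@dif_le K i) dU) -mulmxA maskC.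
  rewrite mulmxBr mulmx1 maskI (@eq_mask _ _ _ _ _ U) ?subrr ?mulmx0 // => p /=.
  exact: andbb.
(* [U] is a downset, so cutting [v] down to the complement of [U] does not change
   its image modulo the basis vectors with degree in [U]. *)
have maskIC : maskmx k (@deg K i) (predI P (predC U)) =
    maskmx k (@deg K i) (predC U) *m maskmx k (@deg K i) P.
  by rewrite maskI; apply: eq_mask => p /=; rewrite andbC.
rewrite {1}maskC mulmxBr mulmx1 !mulmxBl {2}maskIC mulmxA vN mul0mx subr0.
rewrite -maskI mulmxA -uE mulmxBl.
rewrite [u' *m _](_ : _ = 0) ?subr0; last first.
  apply: (@supp_mask0 _ _ _ _ P); apply: sub_supp su' => p /andP[Pp Up] /=.
  by rewrite negbK Pp.
by apply/esym/supp_mask; apply: sub_supp su => p /andP[].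
Qed.

Definition lowreg b (K : seq 'I_n) : pred 'rV[int]_n :=
  fun p => all (fun j => p 0 j < b 0 j) K.

Lemma lowreg_down b K : downset (lowreg b K).
Proof.
move=> p q /dleP pq /allP qK; apply/allP => j /qK; exact: le_lt_trans.
Qed.

(** The conditions [b_j <= deg_j] are imposed one coordinate at a time: the region
    in which they hold for [j :: J] is the complement, in the region for [J], of the
    part in which [deg_j < b_j]. That part is again of the form considered, with
    one more upper bound, so the induction needs all sets of upper bounds. *)
Lemma exact_upset G b : (forall K i, exact_on G (lowreg b K) i) ->
  forall i, exact_on G (dle b) i.
Proof.
move=> exG.
pose upreg (J : seq 'I_n) : pred 'rV[int]_n := fun p => all (fun j => b 0 j <= p 0 j) J.
have exJ J : forall K i, exact_on G (predI (lowreg b K) (upreg J)) i.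
  elim: J => [|j J IHJ] K i.
    have -> : predI (lowreg b K) (upreg [::]) = lowreg b K :> pred _; last exact: exG.
    by apply: boolp.funext => p /=; rewrite andbT.
  pose P : pred 'rV[int]_n := predI (lowreg b K) (upreg J).
  have -> : predI (lowreg b K) (upreg (j :: J)) =
      predI P (predC (lowreg b [:: j])) :> pred _.
    apply: boolp.funext => p /=; rewrite andbT -leNgt -andbA; congr (_ && _).
    exact: andbC.
  apply: exact_quotient => [p q a pq qa /andP[_ pJ] /andP[aK _]| |{}i|{}i].
  - apply/andP; split; first exact: lowreg_down qa aK.
    by apply/allP => l /(allP pJ) /le_trans; apply; apply/dleP.
  - exact: lowreg_down.
  - have -> : predI P (lowreg b [:: j]) =
      predI (lowreg b (j :: K)) (upreg J) :> pred _; last exact: IHJ.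
    apply: boolp.funext => p; rewrite /P /= andbT; symmetry.
    by rewrite [RHS]andbC andbA.
  - exact: IHJ.
move=> i; have := exJ (enum 'I_n) [::] i.
congr (exact_on G _ i); apply: boolp.funext => p; apply/allP/dleP => h j //.
by apply: h; rewrite mem_enum.
Qed.

(** The column vectors supported on [b <= deg] form the dual of the quotient
    complex on that region, and dualizing over a field preserves exactness. *)
Lemma exact_dual G b i : exact_on G (dle b) i ->
  forall z : 'cV[k]_(rk G i), csupp (@deg G i) (dle b) z -> dif G i *m z = 0 ->
  exists2 w, csupp (@pdeg G i) (dle b) w & z = pdif G i *m w.
Proof.
move=> exG z sz zA.
pose X := maskmx k (@deg G i) (dle b) *m pdif G i *m maskmx k (@pdeg G i) (dle b).
(* The rows of [1 - X *m pinvmx X] are cycles, so [z] vanishes on them; therefore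
   [pinvmx X *m z] is a preimage of [z]. *)
have Yz : (1%:M - X *m pinvmx X) *m z = 0.
  have YX : (1%:M - X *m pinvmx X) *m X = 0.
    by rewrite mulmxBl mul1mx mulmxKpV ?subrr.
  apply/row_matrixP => j; rewrite row_mul row0.
  set y := row j _.
  have yX : y *m X = 0 by rewrite /y -row_mul YX row0.
  have [||v _ vE] := exG (y *m maskmx k (@deg G i) (dle b)).
  - by move=> l; rewrite mul_maskE; case: ifP; rewrite ?eqxx.
  - by rewrite -yX /X !mulmxA.
  rewrite -(csupp_mask sz) mulmxA vE -!mulmxA csupp_mask // zA.
  by rewrite mulmx0.
have {}Yz : z = X *m (pinvmx X *m z).
  by apply/eqP; rewrite mulmxA -subr_eq0 -{1}[z]mul1mx -mulmxBl Yz.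
exists (maskmx k (@pdeg G i) (dle b) *m (pinvmx X *m z)); first exact: mask_csupp.
rewrite {1}Yz /X -!mulmxA csupp_mask //.
by apply: lower_csupp (@pdif_le G i) _; apply: mask_csupp.
Qed.

End Complexes.

(** * Mapping cones and the comparison of cohomology *)
Section Cone.
Variables (k : fieldType) (n : nat).
Implicit Types (P U : pred 'rV[int]_n) (p q b : 'rV[int]_n).

Definition dge q : pred 'rV[int]_n := fun p => dle p q.

Lemma dge_down q : downset (dge q).
Proof. by move=> p a; apply: dle_trans. Qed.

(** [K], augmented by [a], is exact in every degree, where the augmentation module
    is a quotient of [S]: it is [k] in the degrees satisfying [T] and zero in the
    others. *)
Record resolves (K : gcomplex k n) (T : 'rV[int]_n -> Prop) (a : 'cV[k]_(rk K 0)) : Prop := {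
  res_onto : forall q, T q -> exists2 u, supp (@deg _ _ K 0) (dge q) u & u *m a = 1%:M;
  res_exact0 : forall q u, supp (@deg _ _ K 0) (dge q) u -> (T q -> u *m a = 0) ->
    exists2 v, supp (@deg _ _ K 1) (dge q) v & u = v *m dif K 0;
  res_aug0 : forall q v, supp (@deg _ _ K 1) (dge q) v -> T q -> v *m dif K 0 *m a = 0;
  res_exactS : forall m q u, supp (@deg _ _ K m.+1) (dge q) u -> u *m dif K m = 0 ->
    exists2 v, supp (@deg _ _ K m.+2) (dge q) v & u = v *m dif K m.+1 }.

Variables (K K' : gcomplex k n) (Phi : forall m, 'M[k]_(rk K m, rk K' m)).
Hypothesis Phi_le : forall m, lower (@deg _ _ K m) (@deg _ _ K' m) (Phi m).
Hypothesis Phi_dif : forall m, dif K m *m Phi m = Phi m.+1 *m dif K' m.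

(** Stage [m] is [K_(m-1)] plus [K'_m], with [K_(-1) = 0]. *)
Definition cone_rk m := (prk K m + rk K' m)%N.

Definition cone_deg m (i : 'I_(cone_rk m)) : 'rV[int]_n :=
  match split i with inl j => pdeg j | inr j => deg j end.

Definition cone_dif m : 'M[k]_(cone_rk m.+1, cone_rk m) :=
  block_mx (- pdif K m) (Phi m) 0 (dif K' m).

Fact cone_dif_le m : lower (@cone_deg m.+1) (@cone_deg m) (cone_dif m).
Proof.
move=> i j; rewrite /cone_deg -{1}[i]splitK -{1}[j]splitK.
case: (split i) => i'; case: (split j) => j' /=; rewrite /unsplit.
- by rewrite block_mxEul mxE oppr_eq0 => /pdif_le.
- by rewrite block_mxEur => /Phi_le.
- by rewrite block_mxEdl mxE eqxx.
- by rewrite block_mxEdr => /dif_le.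
Qed.

Fact cone_dif_comp m : cone_dif m.+1 *m cone_dif m = 0.
Proof.
rewrite /cone_dif mulmx_block /= !mul0mx !mulmx0 !addr0 dif_comp add0r.
by rewrite mulNmx mulmxN opprK pdif_comp mulNmx Phi_dif addNr -[RHS]block_mx0.
Qed.

Definition cone : gcomplex k n := GComplex cone_dif_le cone_dif_comp.

Variables (T T' : 'rV[int]_n -> Prop) (a : 'cV[k]_(rk K 0)) (a' : 'cV[k]_(rk K' 0)).
Hypotheses (resK : resolves T a) (resK' : resolves T' a').
Hypothesis Phi_aug : forall q u, supp (@deg _ _ K 0) (dge q) u -> T' q ->
  u *m a = u *m Phi 0 *m a'.

Lemma cone_supp m P (x : 'rV[k]_(prk K m)) (y : 'rV[k]_(rk K' m)) :
  supp (@cone_deg m) P (row_mx x y) <->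
  supp (@pdeg _ _ K m) P x /\ supp (@deg _ _ K' m) P y.
Proof.
split=> [s|[sx sy] j].
  split=> j h.
    have := s (lshift _ j); rewrite row_mxEl /cone_deg.
    by rewrite (unsplitK (inl _ j)) => /(_ h).
  have := s (rshift _ j); rewrite row_mxEr /cone_deg.
  by rewrite (unsplitK (inr _ j)) => /(_ h).
rewrite /cone_deg -{1}[j]splitK; case: (split j) => j' /=.
  by rewrite row_mxEl => /sx.
by rewrite row_mxEr => /sy.
Qed.

(** If [T q] and [T' q] are equivalent, then [Phi] induces an isomorphism on the only
    homology group of the pieces of degree [q], so the cone is exact there. *)
Lemma cone_exact_at q : (T q <-> T' q) -> forall i (u : 'rV[k]_(cone_rk i)),
  supp (@cone_deg i) (dge q) u -> u *m pdif cone i = 0 ->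
  exists2 v, supp (@cone_deg i.+1) (dge q) v & u = v *m dif cone i.
Proof.
move=> TT' i u; rewrite -[u]hsubmxK.
move: (lsubmx u) (rsubmx u) => x y {u} /cone_supp[sx sy].
case: i x y sx sy => [|[|i]] x y sx sy.
- move=> _; have [w sw wE] : exists2 w, supp (@deg _ _ K 0) (dge q) w &
      T' q -> (y - w *m Phi 0) *m a' = 0.
    have [Tq|nTq] := boolp.EM (T' q); last first.
      by exists 0 => // j; rewrite mxE eqxx.
    have [w0 sw0 w0E] := res_onto resK (TT'.2 Tq).
    exists (y *m a' *m w0) => [j|_].
      rewrite mxE big_ord1 => h; apply: sw0; apply: contraNneq h => ->.
      by rewrite mulr0.
    have sw0' : supp (@deg _ _ K 0) (dge q) (y *m a' *m w0).
      move=> j; rewrite mxE big_ord1 => h; apply: sw0; apply: contraNneq h => ->.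
      by rewrite mulr0.
    by rewrite mulmxBl -(Phi_aug sw0' Tq) -[_ *m w0 *m a]mulmxA w0E mulmx1 subrr.
  have [|v sv vE] := res_exact0 resK' (u := y - w *m Phi 0) (q := q) _ wE.
    apply: suppD sy (suppN _); exact: lower_supp (@Phi_le 0) (@dge_down q) sw.
  exists (row_mx w v); first exact/cone_supp.
  rewrite [dif cone 0]/(cone_dif 0) mul_row_block mulmx0 addr0 -vE.
  by rewrite addrC subrK; congr row_mx; rewrite [LHS]thinmx0 [RHS]thinmx0.
- rewrite [pdif cone 1]/(cone_dif 0) mul_row_block -[0 in RHS]row_mx0.
  move=> /eq_row_mx[_ xy].
  have [|w sw wE] := res_exact0 resK (u := x) (q := q) sx.
    move=> Tq; have T'q := TT'.1 Tq.
    rewrite (Phi_aug sx T'q) (_ : x *m Phi 0 = - (y *m dif K' 0)); last first.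
      by apply/eqP; rewrite -addr_eq0 xy.
    by rewrite mulNmx (res_aug0 resK' sy T'q) oppr0.
  have [||v sv vE] := res_exactS resK' (m := 0) (u := y + w *m Phi 1) (q := q).
  - apply: suppD sy _; exact: lower_supp (@Phi_le 1) (@dge_down q) sw.
  - by rewrite mulmxDl -mulmxA -Phi_dif mulmxA -wE addrC xy.
  exists (row_mx (- w) v); first by apply/cone_supp; split=> //; apply: suppN.
  rewrite [dif cone 1]/(cone_dif 1) mul_row_block mulmx0 addr0 -vE.
  by rewrite mulNmx mulmxN opprK -wE mulNmx addrC addrK.
- rewrite [pdif cone _]/(cone_dif i.+1) mul_row_block mulmx0 addr0 -[0 in RHS]row_mx0.
  move=> /eq_row_mx[/eqP]; rewrite mulmxN oppr_eq0 => /eqP xA xy.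
  have [w sw wE] := res_exactS resK sx xA.
  have [||v sv vE] := res_exactS resK' (m := i.+1) (u := y + w *m Phi i.+2) (q := q).
  - apply: suppD sy _; exact: lower_supp (@Phi_le _) (@dge_down q) sw.
  - by rewrite mulmxDl -mulmxA -Phi_dif mulmxA -wE addrC xy.
  exists (row_mx (- w) v); first by apply/cone_supp; split=> //; apply: suppN.
  rewrite [dif cone _]/(cone_dif i.+2) mul_row_block mulmx0 addr0 -vE.
  by rewrite mulNmx mulmxN opprK -wE mulNmx addrC addrK.
Qed.

(** The basis vectors of degree at most [corner b L Q], for [Q] large, are those with
    [deg_j < b_j] for all [j] in [L]. *)
Definition corner b (L : seq 'I_n) (Q : int) : 'rV[int]_n :=
  \row_j (if j \in L then b 0 j - 1 else Q).

Lemma cornerE b L Q j : corner b L Q 0 j = if j \in L then (b 0%R j - 1)%R else Q.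
Proof. exact: mxE. Qed.

(** At a fixed stage of the cone only finitely many degrees occur, so a region given
    by upper bounds on some of the coordinates is, at that stage, the piece of a
    single degree. *)
Lemma cone_exact b (Q0 : int) :
  (forall L Q, Q0 <= Q -> T (corner b L Q) <-> T' (corner b L Q)) ->
  forall i, exact_on cone (dle b) i.
Proof.
move=> TT'; apply: exact_upset => L i u su.
have suA : supp (@pdeg _ _ cone i) (lowreg b L) (u *m pdif cone i).
  exact: lower_supp (@pdif_le _ _ cone i) (@lowreg_down _ b L) su.
rewrite (supp_mask suA) => uA.
pose Q := `|Q0| + \sum_(j < cone_rk i) \sum_(l < n) `|cone_deg j 0 l|.
have QQ0 : Q0 <= Q.
  apply: le_trans (ler_norm _) _; rewrite /Q lerDl; apply: sumr_ge0 => j _.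
  by apply: sumr_ge0 => l _.
have degQ j l : cone_deg (m := i) j 0 l <= Q.
  rewrite /Q (bigD1 j) //= (bigD1 l) //=; apply: le_trans (ler_norm _) _.
  rewrite -[(_ + _ + _)%R]addrA [leRHS]addrCA lerDl !addr_ge0 //; last first.
    by apply: sumr_ge0 => ? _; apply: sumr_ge0 => ? _.
  by apply: sumr_ge0.
have boxP p : dge (corner b L Q) p -> lowreg b L p.
  move/dleP => pq; apply/allP => j jL; have := pq j.
  by rewrite mxE jL -lezD1 -lerBrDr.
have [||v sv vE] := cone_exact_at (TT' L Q QQ0) (u := u) (i := i).
- move=> j /su /allP jL; apply/dleP => l; rewrite mxE; case: ifP => [/jL|_].
    by rewrite lerBrDr lezD1.
  exact: degQ.
- exact: uA.
exists v; first exact: sub_supp sv.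
by rewrite -vE supp_mask.
Qed.

Variables (b : 'rV[int]_n) (Q0 : int).
Hypothesis TT' : forall L Q, Q0 <= Q -> T (corner b L Q) <-> T' (corner b L Q).

Lemma cone_csupp m P (x : 'cV[k]_(prk K m)) (y : 'cV[k]_(rk K' m)) :
  csupp (@cone_deg m) P (col_mx x y) <->
  csupp (@pdeg _ _ K m) P x /\ csupp (@deg _ _ K' m) P y.
Proof.
split=> [s|[sx sy] j].
  split=> j h.
    have := s (lshift _ j); rewrite col_mxEu /cone_deg.
    by rewrite (unsplitK (inl _ j)) => /(_ h).
  have := s (rshift _ j); rewrite col_mxEd /cone_deg.
  by rewrite (unsplitK (inr _ j)) => /(_ h).
rewrite /cone_deg -{1}[j]splitK; case: (split j) => j' /=.
  by rewrite col_mxEu => /sx.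
by rewrite col_mxEd => /sy.
Qed.

(** With [b = -p] the columns supported on [b <= deg] at stage [i] of [K] form
    [Hom(K_i, S)_p]. A cocycle of the dual of the cone is a cocycle [y] of [K'] together
    with a preimage of [Phi y]; exactness makes [y] a coboundary. *)
Lemma cohomology_inj i (y : 'cV[k]_(rk K' i)) (x : 'cV[k]_(prk K i)) :
  csupp (@deg _ _ K' i) (dle b) y -> csupp (@pdeg _ _ K i) (dle b) x ->
  dif K' i *m y = 0 -> Phi i *m y = pdif K i *m x ->
  exists2 w, csupp (@pdeg _ _ K' i) (dle b) w & y = pdif K' i *m w.
Proof.
move=> sy sx yA yE.
have [||w sw] := exact_dual (cone_exact TT' (i := i)) (z := col_mx x y).
- exact/cone_csupp.
- rewrite [dif cone i]/(cone_dif i) mul_block_col mul0mx add0r yA yE mulNmx addNr.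
  exact: col_mx0.
case: i y x sy sx yA yE w sw => [|i] y x sy sx yA yE w sw.
  rewrite mul0mx -[0]col_mx0 => /eq_col_mx[_ ->].
  by exists 0; [move=> [] | rewrite mulmx0].
move: sw; rewrite -[w]vsubmxK => /cone_csupp[sw1 sw2].
rewrite [pdif cone _]/(cone_dif i) mul_block_col mul0mx add0r.
by move=> /eq_col_mx[_ ->]; exists (dsubmx w).
Qed.

(** Here a cocycle [x] of [K] is completed by zero to a cocycle of the dual of the
    cone. *)
Lemma cohomology_onto i (x : 'cV[k]_(rk K i)) :
  csupp (@deg _ _ K i) (dle b) x -> dif K i *m x = 0 ->
  exists y w, [/\ csupp (@deg _ _ K' i) (dle b) y, csupp (@pdeg _ _ K i) (dle b) w,
    dif K' i *m y = 0 & x = Phi i *m y + pdif K i *m w].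
Proof.
move=> sx xA.
have [||w] := exact_dual (cone_exact TT' (i := i.+1)) (z := col_mx x 0).
- by apply/cone_csupp; split=> // j; rewrite mxE eqxx.
- rewrite [dif cone _]/(cone_dif i.+1) mul_block_col !mulmx0 !addr0 mulNmx.
  by rewrite [pdif K i.+1]/(dif K i) xA oppr0 mul0mx; exact: col_mx0.
rewrite -[w]vsubmxK => /cone_csupp[sw1 sw2].
rewrite [pdif cone _]/(cone_dif i) mul_block_col mul0mx add0r.
move=> /eq_col_mx[-> /esym yA]; exists (dsubmx w), (- usubmx w); split=> //.
  exact: csuppN.
by rewrite mulmxN mulNmx addrC.
Qed.

End Cone.

(** [K] tensored with [S(-e)]; multiplication by [x^e] is a map of degree zero from it
    to [K], with the identity as matrix of scalars. *)
Section Twist.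
Variables (k : fieldType) (n : nat) (K : gcomplex k n) (e : 'rV[int]_n).

Fact twist_le m : lower (fun i => @deg _ _ K m.+1 i + e) (fun i => @deg _ _ K m i + e)
  (dif K m).
Proof. by move=> i j /dif_le h; rewrite -[e]opprK; apply: dle_sub. Qed.

Definition twist : gcomplex k n := GComplex twist_le (@dif_comp _ _ K).

Lemma twist_dge r (d : 'I_r -> 'rV[int]_n) q (u : 'rV[k]_r) :
  supp (fun i => d i + e) (dge q) u <-> supp d (dge (q - e)) u.
Proof.
split=> s j /s; rewrite /dge -dle0B -[in X in _ -> X]dle0B.
  by rewrite opprD addrA addrAC.
by rewrite opprD addrA addrAC.
Qed.

Lemma twist_resolves T (a : 'cV[k]_(rk K 0)) : resolves T a ->
  resolves (K := twist) (fun q => T (q - e)) a.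
Proof.
case=> r1 r2 r3 r4; split.
- by move=> q /r1[u su uE]; exists u => //; apply/twist_dge.
- by move=> q u /twist_dge su /(r2 _ _ su)[v sv ->]; exists v => //; apply/twist_dge.
- by move=> q v /twist_dge sv; apply: r3.
- by move=> m q u /twist_dge su /(r4 _ _ _ su)[v sv ->]; exists v => //; apply/twist_dge.
Qed.

End Twist.

(** * Monomials outside the powers of a square-free monomial ideal *)
Section Standard.
Variables (k : fieldType) (n : nat).
Local Notation S := {mpoly k[n]}.
Implicit Types (f g : S) (m : 'X_{1..n}) (q : 'rV[int]_n).

Lemma mcoeffMX_neq0 f m m' : (f * 'X_[m])@_m' != 0 -> (m <= m')%MM.
Proof.
rewrite -mcoeff_msupp (perm_mem (msuppMX _ _)) => /mapP[m0 _ ->].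
exact: lem_addr.
Qed.

Lemma ideal_genM (Gen : S -> Prop) f g : ideal_gen Gen f -> ideal_gen Gen (g * f).
Proof.
move=> [r [c [h [hG ->]]]]; exists r, (fun s => g * c s), h; split=> //.
by rewrite mulr_sumr; apply: eq_bigr => s _; rewrite mulrA.
Qed.

Lemma ideal_gen0 (Gen : S -> Prop) : ideal_gen Gen 0.
Proof. by exists 0%N, (fun=> 0), (fun=> 0); split=> [[]|]; rewrite ?big_ord0. Qed.

(** The degrees [q] in which [S/J] does not vanish, for a monomial ideal [J]. *)
Definition standard (J : S -> Prop) q : Prop := dle 0 q /\ ~ J 'X_[xmon q].

(** What is used of a monomial ideal: it is closed under multiplication, and its
    elements involve only monomials that belong to it. *)
Definition monomial_ideal (J : S -> Prop) : Prop :=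
  [/\ J 0, forall f g, J f -> J (g * f) &
      forall q f, J f -> standard J q -> scal q f = 0].

Variables (G : 'X_{1..n} -> Prop) (B : S -> Prop).
Hypothesis Gsqf : forall m, G m -> squarefree m.
Hypothesis BG : forall f, B f <-> ideal_gen (fun g => exists2 m, G m & g = 'X_[m]) f.

Lemma ideal_gen_supp (H : 'X_{1..n} -> Prop) (F : 'X_{1..n} -> S) f m :
  (forall m, exists m', F m = 'X_[m']) ->
  ideal_gen (fun g => exists2 m, H m & g = F m) f -> f@_m != 0 ->
  exists m1 m2, [/\ H m1, F m1 = 'X_[m2] & (m2 <= m)%MM].
Proof.
move=> FX [r [c [h [hG ->]]]].
rewrite raddf_sum /= => fm.
have [s] : exists s, (c s * h s)@_m != 0.
  apply/existsP; apply: contraNT fm; rewrite negb_exists => /forallP z.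
  by rewrite big1 // => s _; apply/eqP; have := z s; rewrite negbK.
have [m1 Hm1 ->] := hG s; have [m2 FE] := FX m1.
by rewrite FE => /mcoeffMX_neq0; exists m1, m2.
Qed.

(** [x^m] lies in [B^[l]] when [l] times the exponent of a generator is at most [m];
    for a square-free generator this compares with [l] the entries of [m] at the
    variables that occur in it. *)
Lemma monomial_powerP l m : monomial_power B l 'X_[m] <->
  exists2 g, G g & forall j, g j != 0%N -> (l <= m j)%N.
Proof.
have pX m' : exists m'', 'X_[m'] ^+ l = 'X_[m''] :> S by exists (m' *+ l)%MM; rewrite mpolyXn.
have idX m' : exists m'', 'X_[m'] = 'X_[m''] :> S by exists m'.
split=> [Jm|[g Gg gm]].
  have [|m1 [m2 [Bm1]]] := ideal_gen_supp (m := m) pX Jm.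
    by rewrite mcoeffX eqxx oner_neq0.
  rewrite mpolyXn => /(congr1 (mcoeff (m1 *+ l)%MM)).
  rewrite !mcoeffX eqxx; case: eqP => [->|_ /eqP]; last by rewrite oner_eq0.
  move=> _ /mnm_lepP lm.
  have [|g [g' [Gg]]] := ideal_gen_supp (m := m1) idX ((BG _).1 Bm1).
    by rewrite mcoeffX eqxx oner_neq0.
  move=> /(congr1 (mcoeff g)); rewrite !mcoeffX eqxx.
  case: eqP => [->|_ /eqP]; last by rewrite oner_eq0.
  move=> _ /mnm_lepP gm1; exists g => // j gj; apply: leq_trans (lm j).
  by rewrite mulmnE; have := gm1 j; nia.
exists 1%N, (fun=> 'X_[m - g *+ l]), (fun=> 'X_[g] ^+ l); split.
  move=> _; exists g => //; apply/BG; exists 1%N, (fun=> 1), (fun=> 'X_[g]).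
  by split=> [_|]; [exists g | rewrite big_ord1 mul1r].
rewrite big_ord1 mpolyXn -mpolyXD submK //; apply/mnm_lepP => j.
rewrite mulmnE; have := Gsqf Gg j; have := gm j.
by case: (g j) => [|[|//]] //= h _; rewrite mul1n h.
Qed.

Lemma monomial_power_ideal l : monomial_ideal (monomial_power B l).
Proof.
split; [exact: ideal_gen0 | by move=> f g; apply: ideal_genM |].
move=> q f Jf [q0 nJ]; rewrite -(expvec_xmon q0) scal_expvec; apply/eqP.
apply: contra_notT nJ => fq.
have pX m' : exists m'', 'X_[m'] ^+ l = 'X_[m''] :> S by exists (m' *+ l)%MM; rewrite mpolyXn.
have [m1 [m2 [Bm1 m1E m2q]]] := ideal_gen_supp pX Jf fq.
rewrite -(submK m2q) mpolyXD; apply: ideal_genM; rewrite -m1E.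
exists 1%N, (fun=> 1), (fun=> 'X_[m1] ^+ l); split=> [_|]; first by exists m1.
by rewrite big_ord1 mul1r.
Qed.

(** Whether [S/B^[l]] vanishes in degree [q] only depends on the position of the
    entries of [q] with respect to [0] and [l], as [B] has square-free generators. *)
Lemma standard_class l l' q q' :
  (forall j, (0 <= q 0 j) = (0 <= q' 0 j)) ->
  (forall j, 0 <= q 0 j -> (l%:Z <= q 0 j) = (l'%:Z <= q' 0 j)) ->
  standard (monomial_power B l) q <-> standard (monomial_power B l') q'.
Proof.
move=> h0 hl.
have q0q' : dle 0 q = dle 0 q' by apply: eq_forallb => j; rewrite mxE h0.
rewrite /standard -q0q'; split=> -[q0 nJ]; split=> // Jq; apply: nJ.
  have q'0 := q0; rewrite q0q' in q'0; move: Jq => /monomial_powerP[g Gg gq].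
  apply/monomial_powerP; exists g => // j /gq; rewrite !mnmE.
  move/dleP/(_ j): q0; move/dleP/(_ j): q'0; rewrite !mxE => a b.
  by have := hl j b; lia.
have q'0 := q0; rewrite q0q' in q'0; move: Jq => /monomial_powerP[g Gg gq].
apply/monomial_powerP; exists g => // j /gq; rewrite !mnmE.
move/dleP/(_ j): q0; move/dleP/(_ j): q'0; rewrite !mxE => a b.
by have := hl j b; lia.
Qed.

End Standard.

(** * Resolutions in scalar form *)
Section HomogeneousMatrices.
Variables (k : fieldType) (n : nat).
Local Notation S := {mpoly k[n]}.
Implicit Types (p q : 'rV[int]_n).

(** A row vector of degree [q] has entries of degree [q - d j], whereas a column
    vector, seen as a homomorphism of degree [p], has entries of degree [d j + p].
    [rcomp] and [ccomp] read off the scalars of the homogeneous component of a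
    vector, [rlift] and [clift] rebuild a homogeneous vector from its scalars. *)
Definition rcomp r (d : 'I_r -> 'rV[int]_n) q (u : 'rV[S]_r) : 'rV[k]_r :=
  \row_j scal (q - d j) (u 0 j).
Definition rlift r (d : 'I_r -> 'rV[int]_n) q (u : 'rV[k]_r) : 'rV[S]_r :=
  \row_j (u 0 j *: xpow k (q - d j)).
Definition ccomp r (d : 'I_r -> 'rV[int]_n) p (z : 'cV[S]_r) : 'cV[k]_r :=
  \col_j scal (d j + p) (z j 0).
Definition clift r (d : 'I_r -> 'rV[int]_n) p (z : 'cV[k]_r) : 'cV[S]_r :=
  \col_j (z j 0 *: xpow k (d j + p)).

Definition hommx r s (d : 'I_r -> 'rV[int]_n) (d' : 'I_s -> 'rV[int]_n)
  (A : 'M[S]_(r, s)) : Prop := forall i j, homogeneous (d i - d' j) (A i j).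
Definition smat r s (d : 'I_r -> 'rV[int]_n) (d' : 'I_s -> 'rV[int]_n)
  (A : 'M[S]_(r, s)) : 'M[k]_(r, s) := \matrix_(i, j) scal (d i - d' j) (A i j).

Lemma smat_lower r s (d : 'I_r -> 'rV[int]_n) (d' : 'I_s -> 'rV[int]_n) A :
  lower d d' (smat d d' A).
Proof. by move=> i j; rewrite mxE => /scal_ge0; rewrite dle0B. Qed.

Lemma smatM r s t (d : 'I_r -> 'rV[int]_n) (d' : 'I_s -> 'rV[int]_n)
  (d'' : 'I_t -> 'rV[int]_n) A A' : hommx d d' A ->
  smat d d'' (A *m A') = smat d d' A *m smat d' d'' A'.
Proof.
move=> hA; apply/matrixP => i j; rewrite !mxE raddf_sum; apply: eq_bigr => l _.
by rewrite !mxE -scalM //; congr scal; rewrite addrA subrK.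
Qed.

Section OneMatrix.
Variables (r s : nat) (d : 'I_r -> 'rV[int]_n) (d' : 'I_s -> 'rV[int]_n).
Variables (A : 'M[S]_(r, s)).
Hypothesis hA : hommx d d' A.

Lemma rcompM q u : rcomp d' q (u *m A) = rcomp d q u *m smat d d' A.
Proof.
apply/rowP => j; rewrite !mxE raddf_sum; apply: eq_bigr => l _.
by rewrite !mxE -scalMr //; congr scal; rewrite addrA subrK.
Qed.

Lemma ccompM p z : ccomp d p (A *m z) = smat d d' A *m ccomp d' p z.
Proof.
apply/colP => j; rewrite !mxE raddf_sum; apply: eq_bigr => l _.
by rewrite !mxE -scalM //; congr scal; rewrite addrA subrK.
Qed.

Lemma rliftM q u : supp d (dge q) u ->
  rlift d q u *m A = rlift d' q (u *m smat d d' A).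
Proof.
move=> su; apply/rowP => j; rewrite !mxE scaler_suml; apply: eq_bigr => l _.
rewrite !mxE; have [->|/su ul] := eqVneq (u 0 l) 0; first by rewrite mul0r !scale0r mul0r.
move/homogeneousP: (@hA l j) => {1}->.
rewrite -scalerAr -scalerAl scalerA [_ * u 0 l]mulrC.
have [->|/scal_ge0 Al] := eqVneq (scal (d l - d' j) (A l j)) 0.
  by rewrite mulr0 !scale0r.
by rewrite xpowD ?addrA ?subrK // dle0B.
Qed.

Lemma cliftM p z : csupp d' (dle (- p)) z ->
  A *m clift d' p z = clift d p (smat d d' A *m z).
Proof.
move=> su; apply/colP => j; rewrite !mxE scaler_suml; apply: eq_bigr => l _.
rewrite !mxE; have [->|/su ul] := eqVneq (z l 0) 0.
  by rewrite mulr0 !scale0r mulr0.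
move/homogeneousP: (@hA j l) => {1}->.
rewrite -scalerAr -scalerAl scalerA [z l 0 * _]mulrC.
have [->|/scal_ge0 Al] := eqVneq (scal (d j - d' l) (A j l)) 0.
  by rewrite mul0r !scale0r.
rewrite xpowD //; last by rewrite -[p]opprK dle0B.
by rewrite addrA subrK.
Qed.

End OneMatrix.

Lemma rcomp_supp r (d : 'I_r -> 'rV[int]_n) q u : supp d (dge q) (rcomp d q u).
Proof. by move=> j; rewrite mxE => /scal_ge0; rewrite dle0B. Qed.

Lemma ccomp_supp r (d : 'I_r -> 'rV[int]_n) p z : csupp d (dle (- p)) (ccomp d p z).
Proof. by move=> j; rewrite mxE => /scal_ge0; rewrite -{1}[p]opprK dle0B. Qed.

Lemma rliftK r (d : 'I_r -> 'rV[int]_n) q u : supp d (dge q) u ->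
  rcomp d q (rlift d q u) = u.
Proof.
move=> su; apply/rowP => j; rewrite !mxE scalZ scal_xpow eqxx /=.
have [->|/su uj] := eqVneq (u 0 j) 0; first by rewrite mul0r.
by rewrite dle0B (uj : dle _ _) mulr1.
Qed.

Lemma cliftK r (d : 'I_r -> 'rV[int]_n) p z : csupp d (dle (- p)) z ->
  ccomp d p (clift d p z) = z.
Proof.
move=> su; apply/colP => j; rewrite !mxE scalZ scal_xpow eqxx /=.
have [->|/su uj] := eqVneq (z j 0) 0; first by rewrite mul0r.
by rewrite -[p]opprK dle0B uj mulr1.
Qed.

Lemma clift_homogeneous r (d : 'I_r -> 'rV[int]_n) p z j :
  homogeneous (d j + p) (clift d p z j 0).
Proof. by rewrite mxE; apply: homogeneousZx. Qed.

Lemma ccomp_clift_homogeneous r (d : 'I_r -> 'rV[int]_n) p (z : 'cV[S]_r) :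
  (forall j, homogeneous (d j + p) (z j 0)) -> clift d p (ccomp d p z) = z.
Proof. by move=> hz; apply/colP => j; rewrite !mxE -(homogeneousP _ _).1. Qed.

Lemma ccomp_homogeneous r (d : 'I_r -> 'rV[int]_n) p q (z : 'cV[S]_r) :
  (forall j, homogeneous (d j + p) (z j 0)) -> p != q -> ccomp d q z = 0.
Proof.
move=> hz pq; apply/colP => j; rewrite !mxE; apply: scal_homogeneous (hz j) _.
by rewrite (can_eq (addKr (d j))).
Qed.

Lemma ccomp_decomp r (d : 'I_r -> 'rV[int]_n) (z : 'cV[S]_r) :
  exists Ps : seq 'rV[int]_n, z = \sum_(p <- Ps) clift d p (ccomp d p z).
Proof.
exists (undup (flatten [seq [seq expvec m - d j | m <- msupp (z j 0)] | j <- enum 'I_r])).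
set Ps := undup _; apply/colP => j; rewrite summxE.
rewrite [LHS](@scal_decomp _ _ Ps (d j) _ (undup_uniq _)).
  by apply: eq_bigr => p _; rewrite !mxE.
move=> m mz; rewrite mem_undup; apply/flatten_mapP; exists j; rewrite ?mem_enum //.
exact: map_f.
Qed.

End HomogeneousMatrices.

Section ScalarResolution.
Variables (k : fieldType) (n : nat) (J : {mpoly k[n]} -> Prop).
Hypothesis Jmon : monomial_ideal J.
Local Notation S := {mpoly k[n]}.
Variable F : resolution J.

Lemma res_diffK m : res_diff F m.+1 *m res_diff F m = 0.
Proof.
apply/row_matrixP => i; rewrite row_mul row0; apply/exact_at_S.
by exists (delta_mx 0 i); rewrite -rowE.
Qed.

Definition sdif m := smat (@gdeg _ _ _ F m.+1) (@gdeg _ _ _ F m) (res_diff F m).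

Fact sdif_comp m : sdif m.+1 *m sdif m = 0.
Proof.
rewrite -smatM; last exact: diff_homogeneous.
by rewrite res_diffK; apply/matrixP => i j; rewrite !mxE raddf0.
Qed.

Definition gres : gcomplex k n :=
  @GComplex k n (res_rank F) (@gdeg _ _ _ F) sdif
    (fun m => @smat_lower _ _ _ _ _ _ (res_diff F m)) sdif_comp.

Definition saug : 'cV[k]_(res_rank F 0) :=
  smat (@gdeg _ _ _ F 0) (fun=> 0) (aug F).

Lemma aug_hommx : hommx (@gdeg _ _ _ F 0) (fun=> 0) (aug F).
Proof. by move=> i j; rewrite ord1 subr0; apply: aug_homogeneous. Qed.

Lemma saug_scal q u : (rcomp (@gdeg _ _ _ F 0) q u *m saug) 0 0 = scal q ((u *m aug F) 0 0).
Proof.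
by rewrite -(rcompM aug_hommx) mxE subr0.
Qed.

Lemma saug_lift q u : supp (@gdeg _ _ _ F 0) (dge q) u ->
  (rlift (@gdeg _ _ _ F 0) q u *m aug F) 0 0 = (u *m saug) 0 0 *: xpow k q.
Proof.
by move=> su; rewrite (rliftM aug_hommx su) mxE subr0.
Qed.

(** The exactness of a resolution, tested on homogeneous vectors. *)
Lemma gres_resolves : resolves (K := gres) (standard J) saug.
Proof.
case: Jmon => J0 JM Jscal; split.
- move=> q Tq; have [u uJ] := aug_surjective F (xpow k q).
  exists (rcomp (@gdeg _ _ _ F 0) q u); first exact: rcomp_supp.
  rewrite [LHS]mx11_scalar saug_scal; congr (_%:M).
  have := Jscal q _ uJ Tq; rewrite raddfB /= scal_xpow eqxx Tq.1 => /eqP.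
  by rewrite subr_eq0 => /eqP <-.
- move=> q u su uT.
  have /exact_at_0 [v vE] : J ((rlift (@gdeg _ _ _ F 0) q u *m aug F) 0 0).
    rewrite saug_lift //.
    have [Tq|nTq] := boolp.EM (standard J q); first by rewrite uT // mxE scale0r.
    rewrite -mul_mpolyC; apply: JM; rewrite /xpow; case: ifP => // q0.
    by apply: boolp.contrapT => nJ; apply: nTq.
  exists (rcomp (@gdeg _ _ _ F 1) q v); first exact: rcomp_supp.
  by rewrite -[u](rliftK su) vE (rcompM (@diff_homogeneous _ _ _ F _)).
- move=> q v sv Tq; rewrite [LHS]mx11_scalar.
  have J1 : J ((rlift (@gdeg _ _ _ F 1) q v *m res_diff F 0 *m aug F) 0 0).
    by apply/exact_at_0; exists (rlift (@gdeg _ _ _ F 1) q v).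
  have := Jscal q _ J1 Tq.
  rewrite -saug_scal (rcompM (@diff_homogeneous _ _ _ F 0)).
  by rewrite rliftK // => ->; apply/matrixP => i j; rewrite !mxE mul0rn.
- move=> m q u su uA.
  have /exact_at_S [v vE] : rlift (@gdeg _ _ _ F m.+1) q u *m res_diff F m = 0.
    rewrite (rliftM (@diff_homogeneous _ _ _ F m) su) (_ : u *m _ = 0) //.
    by apply/rowP => j; rewrite !mxE scale0r.
  exists (rcomp (@gdeg _ _ _ F m.+2) q v); first exact: rcomp_supp.
  by rewrite -[u](rliftK su) vE (rcompM (@diff_homogeneous _ _ _ F _)).
Qed.

End ScalarResolution.

(** * Homogeneous components of Ext *)
Section ExtComponents.
Variables (k : fieldType) (n : nat) (J : {mpoly k[n]} -> Prop).
Local Notation S := {mpoly k[n]}.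
Variables (F : resolution J) (i : nat).
Implicit Types (p q : 'rV[int]_n) (z : cycles (codiff F i)).
Local Notation deg := (@gdeg _ _ _ F i).

(** The support condition on [w] makes it a homogeneous cochain of degree [p]. *)
Definition coboundary p (y : 'cV[k]_(res_rank F i)) : Prop :=
  exists2 w, csupp (@pdeg _ _ (gres F) i) (dle (- p)) w & y = pdif (gres F) i *m w.

Lemma coboundary0 p : coboundary p 0.
Proof. by exists 0; rewrite ?mulmx0 // => j; rewrite mxE eqxx. Qed.

Lemma coboundaryD p x y : coboundary p x -> coboundary p y -> coboundary p (x + y).
Proof.
move=> [w sw ->] [w' sw' ->]; exists (w + w'); first exact: csuppD.
by rewrite mulmxDr.
Qed.

Lemma coboundaryN p x : coboundary p x -> coboundary p (- x).
Proof. by move=> [w sw ->]; exists (- w); rewrite ?mulmxN //; apply: csuppN. Qed.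

Lemma prediff_hommx : hommx deg (@pdeg _ _ (gres F) i) (prediff F i).
Proof.
by case: i => [|i'] a b; [rewrite mxE => m; rewrite msupp0 | apply: diff_homogeneous].
Qed.

Lemma smat_prediff : smat deg (@pdeg _ _ (gres F) i) (prediff F i) = pdif (gres F) i.
Proof. by case: i => [|i']; first by rewrite [LHS]thinmx0 [RHS]thinmx0. Qed.

Lemma hclass0P z : hclass (codiff_in F i) z = 0 <->
  exists w, cycle_val z = prediff F i *m w.
Proof.
have -> : hclass (codiff_in F i) z = 0 <->
    z - 0 \in @boundary_pred _ _ _ _ (codiff_in F i) (codiff F i).
  split=> [h|/qclassP h]; first by apply/qclassP; rewrite [LHS]h raddf0.
  by rewrite [LHS]h raddf0.
by rewrite subr0 unfold_in; split=> [/boolp.asboolP|h] //; apply/boolp.asboolP.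
Qed.

(** The differential is homogeneous, so a cocycle is a coboundary if and only if each
    of its finitely many homogeneous components is. *)
Lemma hclass_eq0 z : hclass (codiff_in F i) z = 0 <->
  forall p, coboundary p (ccomp deg p (cycle_val z)).
Proof.
rewrite hclass0P; split=> [[w ->] p|h].
  rewrite (ccompM prediff_hommx) smat_prediff.
  by exists (ccomp (@pdeg _ _ (gres F) i) p w); first exact: ccomp_supp.
have [Ps ->] := ccomp_decomp deg (cycle_val z).
elim: Ps => [|p Ps [w wE]]; first by exists 0; rewrite big_nil mulmx0.
have [w' sw' w'E] := h p.
exists (clift (@pdeg _ _ (gres F) i) p w' + w).
rewrite big_cons wE mulmxDr w'E -smat_prediff.
by rewrite -(cliftM prediff_hommx sw').
Qed.

(** The vanishing of the component of degree [p]; it does not depend on the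
    representative ([component0_hclass]). *)
Definition component0 p (x : Ext F i) : Prop :=
  coboundary p (ccomp deg p (cycle_val (qrepr x))).

Lemma ccompB p (x y : 'cV[S]_(res_rank F i)) :
  ccomp deg p (x - y) = ccomp deg p x - ccomp deg p y.
Proof. by apply/colP => j; rewrite !mxE raddfB. Qed.

Lemma component0_hclass p z :
  component0 p (hclass (codiff_in F i) z) <-> coboundary p (ccomp deg p (cycle_val z)).
Proof.
rewrite /component0; set z1 := qrepr _.
have zz1 : hclass (codiff_in F i) (z1 - z) = 0.
  by rewrite /hclass raddfB [X in X - _]qreprK subrr.
have /(_ p) := (hclass_eq0 _).1 zz1.
rewrite [cycle_val _](_ : _ = cycle_val z1 - cycle_val z); last exact: (raddfB val).
rewrite ccompB => h; split=> h1.
  by rewrite -[X in coboundary p X](subKr (ccomp deg p (cycle_val z1)));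
    apply: coboundaryD => //; apply: coboundaryN.
by rewrite -[X in coboundary p X](subrK (ccomp deg p (cycle_val z))); apply: coboundaryD.
Qed.

Lemma Ext_hclass (x : Ext F i) : exists z, x = hclass (codiff_in F i) z.
Proof. by exists (qrepr x); rewrite [RHS]qreprK. Qed.

Lemma Ext_eq0 (x : Ext F i) : x = 0 <-> forall p, component0 p x.
Proof.
have [z ->] := Ext_hclass x; rewrite hclass_eq0.
by split=> h p; apply/component0_hclass.
Qed.

Lemma component00 p : component0 p 0.
Proof. by move: p; apply/Ext_eq0. Qed.

Lemma component0D p x y : component0 p x -> component0 p y -> component0 p (x + y).
Proof.
have [z ->] := Ext_hclass x; have [z' ->] := Ext_hclass y.
have -> : hclass (codiff_in F i) z + hclass (codiff_in F i) z' =
  hclass (codiff_in F i) (z + z') by rewrite /hclass raddfD.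
rewrite !component0_hclass => h h'.
rewrite [cycle_val _](_ : _ = cycle_val z + cycle_val z'); last exact: (raddfD val).
rewrite (_ : ccomp _ _ _ = ccomp deg p (cycle_val z) + ccomp deg p (cycle_val z')).
  exact: coboundaryD.
by apply/colP => j; rewrite !mxE raddfD.
Qed.

Lemma piece_component0 p q x : Ext_piece p x -> p != q -> component0 q x.
Proof.
move=> [z hz ->] pq; apply/component0_hclass.
by rewrite (ccomp_homogeneous hz pq); apply: coboundary0.
Qed.

Lemma piece_eq0 p x : Ext_piece p x -> component0 p x -> x = 0.
Proof.
move=> xp x0; apply/Ext_eq0 => q; have [<- //|] := eqVneq p q.
exact: piece_component0.
Qed.

Definition cocycle p (y : 'cV[k]_(res_rank F i)) : Prop :=
  csupp deg (dle (- p)) y /\ dif (gres F) i *m y = 0.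

Lemma comp_cocycle p z : cocycle p (ccomp deg p (cycle_val z)).
Proof.
split; first exact: ccomp_supp.
rewrite -[dif _ _]/(smat (@gdeg _ _ _ F i.+1) deg (res_diff F i)).
rewrite -(ccompM (@diff_homogeneous _ _ _ F i)).
have /eqP -> : codiff F i (cycle_val z) == 0 by exact: cycleP z.
by apply/colP => j; rewrite !mxE raddf0.
Qed.

Lemma piece_cocycle p (x : Ext F i) : Ext_piece p x ->
  exists z y, [/\ cocycle p y, cycle_val z = clift deg p y & x = hclass (codiff_in F i) z].
Proof.
move=> [z hz ->]; exists z, (ccomp deg p (cycle_val z)).
by split=> //; [apply: comp_cocycle | rewrite ccomp_clift_homogeneous].
Qed.

Lemma cocycle_class p y : cocycle p y ->
  exists2 z, cycle_val z = clift deg p y & Ext_piece p (hclass (codiff_in F i) z).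
Proof.
move=> [sy yA].
have zP : clift deg p y \in cycle_pred (codiff F i).
  rewrite unfold_in /codiff /= (cliftM (@diff_homogeneous _ _ _ F i) sy).
  rewrite -[smat _ _ _]/(dif (gres F) i) yA.
  by apply/eqP/colP => j; rewrite !mxE scale0r.
exists (Cycle zP) => //; exists (Cycle zP) => //= j; exact: clift_homogeneous.
Qed.

Lemma clift_class_eq0 p y z : cocycle p y -> cycle_val z = clift deg p y ->
  hclass (codiff_in F i) z = 0 <-> coboundary p y.
Proof.
move=> [sy _] zy.
have zp : Ext_piece p (hclass (codiff_in F i) z).
  by exists z => // j; rewrite zy; apply: clift_homogeneous.
rewrite -{1}(cliftK sy) -zy -component0_hclass.
by split=> [->|]; [apply: component00 | apply: piece_eq0].
Qed.

Lemma pieceZ p c (x : Ext F i) : Ext_piece p x -> Ext_piece p (c%:MP *: x).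
Proof.
move=> [z hz ->]; exists (c%:MP *: z); last by rewrite /hclass linearZ.
move=> j; rewrite [cycle_val _](_ : _ = c%:MP *: cycle_val z) //.
rewrite mxE mul_mpolyC; move/homogeneousP: (hz j) => ->.
by rewrite scalerA; apply: homogeneousZx.
Qed.

End ExtComponents.

Section ExtMaps.
Variables (k : fieldType) (n : nat) (J J' : {mpoly k[n]} -> Prop).
Local Notation S := {mpoly k[n]}.
Hypotheses (Jmon : monomial_ideal J) (J'mon : monomial_ideal J').
Variables (F : resolution J) (F' : resolution J') (c : reslift F F') (i : nat).
Implicit Types (p q : 'rV[int]_n).

Definition slift m := smat (@gdeg _ _ _ F m) (@gdeg _ _ _ F' m) (reslift_map c m).

Lemma slift_dif m :
  dif (gres F) m *m slift m = slift m.+1 *m dif (gres F') m.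
Proof.
rewrite -[dif (gres F) m]/(smat (@gdeg _ _ _ F m.+1) (@gdeg _ _ _ F m) (res_diff F m)).
rewrite -[dif (gres F') m]/(smat (@gdeg _ _ _ F' m.+1) (@gdeg _ _ _ F' m) (res_diff F' m)).
rewrite -(smatM _ _ (@diff_homogeneous _ _ _ F m)).
by rewrite reslift_diff (smatM _ _ (@reslift_homogeneous _ _ _ _ _ _ c m.+1)).
Qed.

Lemma slift_aug q u : supp (@gdeg _ _ _ F 0) (dge q) u -> standard J' q ->
  u *m saug F = u *m slift 0 *m saug F'.
Proof.
move=> su Tq; rewrite [LHS]mx11_scalar [RHS]mx11_scalar; congr (_%:M).
have hlift := @reslift_homogeneous _ _ _ _ _ _ c 0.
rewrite -(rliftK su); set U := rlift _ _ _.
rewrite -(rcompM hlift) !saug_scal; apply/eqP; rewrite -subr_eq0 -raddfB /= -mulmxA.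
have -> : (U *m aug F) 0 0 - (U *m (reslift_map c 0 *m aug F')) 0 0 =
  (U *m (aug F - reslift_map c 0 *m aug F')) 0 0 by rewrite mulmxBr !mxE.
case: J'mon => _ JM Jscal; rewrite mxE raddf_sum big1 // => j _.
by apply: Jscal Tq; apply: JM; apply: reslift_aug.
Qed.

Lemma Ext_map_hclass z : exists2 z', cycle_val z' = reslift_map c i *m cycle_val z &
  Ext_map c i (hclass (codiff_in F' i) z) = hclass (codiff_in F i) z'.
Proof.
exists (cycmap (@colift_cycle _ _ _ _ _ _ c i) z); first by [].
exact: (homology_mapE (@colift_cycle _ _ _ _ _ _ c i) (@colift_boundary _ _ _ _ _ _ c i) z).
Qed.

Lemma Ext_map_piece p (x : Ext F' i) : Ext_piece p x -> Ext_piece p (Ext_map c i x).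
Proof.
move=> /piece_cocycle[z [y [[sy yA] zy ->]]].
have [z' z'E ->] := Ext_map_hclass z; exists z' => // j.
rewrite z'E zy (cliftM (@reslift_homogeneous _ _ _ _ _ _ c i) sy).
exact: clift_homogeneous.
Qed.

Variables (p : 'rV[int]_n) (Q0 : int).
Hypothesis TT' : forall L Q, Q0 <= Q ->
  standard J (corner (- p) L Q) <-> standard J' (corner (- p) L Q).

Let slift_le m : lower (@deg _ _ (gres F) m) (@deg _ _ (gres F') m) (slift m).
Proof. exact: smat_lower. Qed.

(** The transition map is injective in degree [p] if [S/J] and [S/J'] are nonzero in the
    same corner degrees of [-p]; [Ext_map_onto] is its surjectivity. *)
Lemma Ext_map_component0 (x : Ext F' i) :
  component0 p (Ext_map c i x) -> component0 p x.
Proof.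
have [z ->] := Ext_hclass x; have [z' z'E ->] := Ext_map_hclass z.
move=> /component0_hclass; rewrite z'E (ccompM (@reslift_homogeneous _ _ _ _ _ _ c i)).
move=> [w sw wE]; apply/component0_hclass.
apply: (cohomology_inj slift_le slift_dif (gres_resolves Jmon F) (gres_resolves J'mon F')
  slift_aug TT' (@ccomp_supp k n _ _ p (cycle_val z)) sw _ wE).
by case: (comp_cocycle p z).
Qed.

Lemma Ext_map_onto (x : Ext F i) : Ext_piece p x ->
  exists2 x', Ext_piece p x' & Ext_map c i x' = x.
Proof.
move=> /piece_cocycle[z [y [[sy yA] zy ->]]].
have [y' [w [sy' sw yA' yE]]] :=
  cohomology_onto slift_le slift_dif (gres_resolves Jmon F) (gres_resolves J'mon F')
  slift_aug TT' sy yA.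
have [z' z'E z'p] := cocycle_class (conj sy' yA').
exists (hclass (codiff_in F' i) z') => //.
have [z'' z''E ->] := Ext_map_hclass z'.
apply/esym/qclassP; rewrite unfold_in; apply/boolp.asboolP.
exists (clift (@pdeg _ _ (gres F) i) p w).
rewrite (raddfB val) /= z''E zy z'E yE (cliftM (@reslift_homogeneous _ _ _ _ _ _ c i) sy').
rewrite /codiff_in /= (cliftM (@prediff_hommx _ _ _ F i) sw) smat_prediff.
apply/eqP; rewrite subr_eq; apply/eqP/colP => j.
by rewrite !mxE -scalerDl addrC.
Qed.

End ExtMaps.

(** * Ext of the powers of B degree by degree *)
Section Multiplication.
Variables (k : fieldType) (n : nat) (J : {mpoly k[n]} -> Prop).
Local Notation S := {mpoly k[n]}.
Hypothesis Jmon : monomial_ideal J.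
Variables (F : resolution J) (i : nat).
Variables (p e : 'rV[int]_n) (Q0 : int).
Hypothesis e0 : dle 0 e.
Hypothesis TT' : forall L Q, Q0 <= Q ->
  standard J (corner (- p) L Q - e) <-> standard J (corner (- p) L Q).

Let K := twist (gres F) e.
Let Phi m : 'M[k]_(rk K m, rk (gres F) m) := 1%:M.

Let Phi_le m : lower (@deg _ _ K m) (@deg _ _ (gres F) m) (Phi m).
Proof.
move=> a b; rewrite mxE; case: (a =P b) => [->|]; last by rewrite eqxx.
move=> _; apply/dleP => j; rewrite /K /= !mxE lerDl.
by move/dleP/(_ j): e0; rewrite mxE.
Qed.

Let Phi_dif m : dif K m *m Phi m = Phi m.+1 *m dif (gres F) m.
Proof. by rewrite mulmx1 mul1mx. Qed.

Let Phi_aug q u : supp (@deg _ _ K 0) (dge q) u -> standard J q ->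
  u *m saug F = u *m Phi 0 *m saug F.
Proof. by rewrite mulmx1. Qed.

Lemma dle_shift a : dle (- p) (a + e) = dle (- (p + e)) a.
Proof. by rewrite -dle0B -[RHS]dle0B !opprK -addrA [e + p]addrC. Qed.

Lemma csupp_shift m (w : 'cV[k]_(prk (gres F) m)) :
  csupp (@pdeg _ _ (gres F) m) (dle (- (p + e))) w <-> csupp (@pdeg _ _ K m) (dle (- p)) w.
Proof.
case: m w => [|m] w; split=> h j wj; have := h j wj; first by case: j {wj}.
- by case: j {wj}.
- by rewrite /= dle_shift.
- by rewrite /= dle_shift.
Qed.

Lemma shift_coboundary (y : 'cV[k]_(res_rank F i)) :
  cocycle p y -> coboundary (p + e) y -> coboundary p y.
Proof.
move=> [sy yA] [w /csupp_shift sw wE].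
apply: (cohomology_inj Phi_le Phi_dif (twist_resolves e (gres_resolves Jmon F))
  (gres_resolves Jmon F) Phi_aug TT' sy sw yA).
by rewrite mul1mx wE; congr (_ *m _).
Qed.

Lemma shift_cocycle (y : 'cV[k]_(res_rank F i)) : cocycle p y -> cocycle (p + e) y.
Proof.
move=> [sy yA]; split=> // j /sy; rewrite -dle_shift => /dle_trans; apply.
by apply/dleP => l; rewrite mxE lerDl; move/dleP/(_ l): e0; rewrite mxE.
Qed.

Lemma coboundary_shift (y : 'cV[k]_(res_rank F i)) : coboundary p y -> coboundary (p + e) y.
Proof.
move=> [w sw wE]; exists w => // j /sw; rewrite -dle_shift => /dle_trans; apply.
by apply/dleP => l; rewrite mxE lerDl; move/dleP/(_ l): e0; rewrite mxE.
Qed.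

Lemma shift_cocycle_onto (y : 'cV[k]_(res_rank F i)) : cocycle (p + e) y ->
  exists y' w, [/\ cocycle p y', coboundary (p + e) w & y = y' + w].
Proof.
move=> [sy yA].
have sy' : csupp (@deg _ _ K i) (dle (- p)) y by move=> j /sy; rewrite -dle_shift.
have [y' [w [sy1 sw yA' yE]]] :=
  cohomology_onto Phi_le Phi_dif (twist_resolves e (gres_resolves Jmon F))
    (gres_resolves Jmon F) Phi_aug TT' sy' yA.
exists y', (pdif (gres F) i *m w); split=> //; first by exists w => //; apply/csupp_shift.
by rewrite yE mul1mx; congr (_ + _ *m _).
Qed.

(** Both directions hold because multiplication by [x^e] is bijective from [Ext_p] to
    [Ext_(p+e)]: on scalars it is the identity, so [shift_coboundary] is its
    injectivity and [shift_cocycle_onto] its surjectivity. *)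
Lemma Ext_shift_neq0 : (exists2 x : Ext F i, Ext_piece p x & x <> 0) <->
  (exists2 x : Ext F i, Ext_piece (p + e) x & x <> 0).
Proof.
split=> -[x /piece_cocycle[z [y [cy zy ->]]]] /(contra_not (clift_class_eq0 cy zy).2).
  move=> ny; have cy' := shift_cocycle cy.
  have [z' z'y z'p] := cocycle_class cy'.
  exists (hclass (codiff_in F i) z') => // /(clift_class_eq0 cy' z'y).
  by move/(shift_coboundary cy).
have [y' [w [cy' cw ->]]] := shift_cocycle_onto cy => ny.
have [z' z'y z'p] := cocycle_class cy'.
exists (hclass (codiff_in F i) z') => // /(clift_class_eq0 cy' z'y) h.
by apply: ny; apply: coboundaryD => //; apply: coboundary_shift.
Qed.

End Multiplication.

Section Powers.
Variables (k : fieldType) (n : nat) (B : {mpoly k[n]} -> Prop).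
Hypothesis hB : squarefree_monomial_ideal B.
Variables (l i : nat) (F : resolution (monomial_power B l)).
Implicit Types (p q : 'rV[int]_n).

Lemma standard_power_class l1 l2 q q' :
  (forall j, (0 <= q 0 j) = (0 <= q' 0 j)) ->
  (forall j, 0 <= q 0 j -> (l1%:Z <= q 0 j) = (l2%:Z <= q' 0 j)) ->
  standard (monomial_power B l1) q <-> standard (monomial_power B l2) q'.
Proof. by case: hB => G [Gsqf BG]; apply: (standard_class Gsqf BG). Qed.

(** Multiplication by a power of [x_j] maps [Ext] in a degree in which the free modules
    of the dual complex have no elements onto [Ext_p]. *)
Lemma Ext_piece_low p j (x : Ext F i) : p 0 j < - l%:Z -> Ext_piece p x -> x = 0.
Proof.
move=> pj /piece_cocycle[z [y [cy zy ->]]].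
(* [N] exceeds all the relevant degrees, so that no basis vector of [F_i] has degree
   at least [- p0]. *)
pose N : int := `|p 0 j| + \sum_(a < res_rank F i) `|gdeg (r := F) a 0 j|.
have N0 : 0 <= N by rewrite addr_ge0 // sumr_ge0.
pose e : 'rV[int]_n := \row_a (if a == j then N + 1 else 0).
pose p0 := p - e.
have e0 : dle 0 e by apply/dleP => a; rewrite !mxE; case: eqP => // _; lia.
have pE : p = p0 + e by rewrite subrK.
have TT' L Q : l%:Z + N + 1 <= Q ->
  standard (monomial_power B l) (corner (- p0) L Q - e) <->
  standard (monomial_power B l) (corner (- p0) L Q).
  move=> hQ; apply: standard_power_class => a; rewrite !(coordE, cornerE) !mxE.
    by case: eqP => [->|_]; rewrite ?subr0 //; case: ifP => _; lia.
  by case: eqP => [->|_]; rewrite ?subr0 //; case: ifP => _; lia.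
rewrite pE in cy zy.
apply/(clift_class_eq0 cy zy).
have [y' [w [[sy' _] cw ->]]] := shift_cocycle_onto (monomial_power_ideal B l) e0 TT' cy.
rewrite [y'](_ : _ = 0) ?add0r //.
apply/colP => a; rewrite mxE; apply/eqP; apply/negP => /negP /sy' /dleP /(_ j).
rewrite !coordE !mxE eqxx /N (bigD1 a) //=.
have : 0 <= \sum_(b < res_rank F i | b != a) `|gdeg (r := F) b 0 j| by apply: sumr_ge0.
by move: (\sum_(_ < _ | _) _) => s; move: (gdeg a 0 j) => g; lia.
Qed.

(** Both [p] and [p'] are reached by multiplication from their entrywise minimum,
    which has the same negative entries. *)
Lemma Ext_piece_neg_set p p' : (forall j, - l%:Z <= p 0 j) -> (forall j, - l%:Z <= p' 0 j) ->
  neg_set p = neg_set p' ->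
  (exists2 x : Ext F i, Ext_piece p x & x <> 0) ->
  exists2 x : Ext F i, Ext_piece p' x & x <> 0.
Proof.
move=> lp lp' pp'.
have sgn j : (p 0 j < 0) = (p' 0 j < 0).
  by move/setP/(_ j): pp'; rewrite !inE.
pose m : 'rV[int]_n := \row_j Num.min (p 0 j) (p' 0 j).
have lm j : - l%:Z <= m 0 j by rewrite mxE le_min lp lp'.
have TT' q L Q : (forall j, m 0 j <= q 0 j) ->
  (forall j, (m 0 j < 0) = (q 0 j < 0)) ->
  l%:Z + \sum_j `|q 0 j - m 0 j| <= Q ->
  standard (monomial_power B l) (corner (- m) L Q - (q - m)) <->
  standard (monomial_power B l) (corner (- m) L Q).
  move=> mq sq hQ.
  have hd a : `|q 0 a - m 0 a| <= \sum_j `|q 0 j - m 0 j|.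
    by rewrite (bigD1 a) //= lerDl; apply: sumr_ge0.
  apply: standard_power_class => a; have := hd a; have := lm a; have := mq a; have := sq a;
    move: hQ; rewrite !(coordE, cornerE); move: (\sum_j _) => s;
    move: (m 0 a) (q 0 a) => ma qa; case: ifP => _; lia.
have mp j : m 0 j <= p 0 j by rewrite mxE ge_min lexx.
have mp' j : m 0 j <= p' 0 j by rewrite mxE ge_min lexx orbT.
have sm j : (m 0 j < 0) = (p 0 j < 0) by rewrite mxE gt_min -sgn orbb.
have sm' j : (m 0 j < 0) = (p' 0 j < 0) by rewrite sm.
have e0 : dle 0 (p - m) by rewrite dle0B; apply/dleP.
have e0' : dle 0 (p' - m) by rewrite dle0B; apply/dleP.
have h := Ext_shift_neq0 (monomial_power_ideal B l) F i e0 (fun L Q => TT' p L Q mp sm).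
have h' := Ext_shift_neq0 (monomial_power_ideal B l) F i e0' (fun L Q => TT' p' L Q mp' sm').
by rewrite addrC subrK in h; rewrite addrC subrK in h'; rewrite -h h'.
Qed.

End Powers.

Section PowerMaps.
Variables (k : fieldType) (n : nat) (B : {mpoly k[n]} -> Prop).
Hypothesis hB : squarefree_monomial_ideal B.
Variables (l i : nat) (F : resolution (monomial_power B l)).
Variables (F1 : resolution (monomial_power B l.+1)) (c : reslift F1 F).
Implicit Types (p q : 'rV[int]_n).

Lemma standard_power_step p : (forall j, - l%:Z <= p 0 j) -> forall L Q, l.+1%:Z <= Q ->
  standard (monomial_power B l.+1) (corner (- p) L Q) <->
  standard (monomial_power B l) (corner (- p) L Q).
Proof.
move=> lp L Q hQ; apply: (standard_power_class hB) => j //; rewrite !(coordE, cornerE).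
by have := lp j; case: ifP; lia.
Qed.

(** Components of degree [p >= -l] inject by [Ext_map_component0], and the other
    components of [Ext] at stage [l] vanish. *)
Lemma Ext_map_inj : injective (Ext_map c i).
Proof.
apply: raddf_inj => x x0; apply/Ext_eq0 => p.
have [lp|] := boolP [forall j, - l%:Z <= p 0 j].
  apply: (Ext_map_component0 (c := c) (monomial_power_ideal B _)
    (monomial_power_ideal B _) (standard_power_step (forallP lp))).
  by rewrite x0; apply: component00.
rewrite negb_forall => /existsP[j]; rewrite -ltNge => pj.
have [z xz] := Ext_hclass x; rewrite xz; apply/component0_hclass.
have cz := comp_cocycle p z; have [z' z'E z'p] := cocycle_class cz.
apply/(clift_class_eq0 cz z'E).
exact: (Ext_piece_low hB pj z'p).
Qed.

Lemma Ext_map_piece_onto p : (forall j, - l%:Z <= p 0 j) -> forall x : Ext F1 i,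
  Ext_piece p x -> exists2 x' : Ext F i, Ext_piece p x' & Ext_map c i x' = x.
Proof.
move=> lp x.
exact: (Ext_map_onto (monomial_power_ideal B _) (monomial_power_ideal B _) c
  (standard_power_step lp)).
Qed.

End PowerMaps.

(** * The direct limit *)
Section DirectLimitInj.
Variables (R : nzRingType) (E : nat -> lmodType R) (t : forall l, {linear E l -> E l.+1}).

(** If [x] at stage [l] becomes zero, the relation that kills it is given by a finitely
    supported family [u] with [u (m + 1) = t (u m)] from stage [l] on; injectivity
    propagates the eventual vanishing of [u] back to stage [l], where [u l = x]. *)
Lemma dirlim_map_inj : (forall l, injective (t l)) ->
  forall l, injective (dirlim_map t l).
Proof.
move=> tinj l; apply: raddf_inj => x x0.
have : qclass (rel_pred t) (indsum x) = qclass (rel_pred t) 0 by rewrite raddf0.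
move/qclassP; rewrite subr0 unfold_in => /boolp.asboolP[[u uP] uE].
have {}uE m : inprod x m = u m - shift t u m by exact: uE m.
move: uP; rewrite unfold_in => /boolp.asboolP[N uN].
have low m : (m < l)%N -> u m = 0.
  elim: m => [|m IHm] ml.
    have := uE 0%N; rewrite /= subr0 => <-.
    by rewrite /inprod dfwith_out // gtn_eqF.
  have := uE m.+1; rewrite /= IHm 1?ltnW // linear0 subr0 => <-.
  by rewrite /inprod dfwith_out // gtn_eqF.
have high d : u (l + (N - d))%N = 0.
  elim: d => [|d IHd]; first by apply: uN; rewrite subn0 leq_addl.
  have [Nd|dN] := leqP N d.
    by have <- : (l + (N - d) = l + (N - d.+1))%N by lia.
  have dE : (l + (N - d) = (l + (N - d.+1)).+1)%N by lia.
  move: IHd; rewrite dE.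
  set m := (l + (N - d.+1))%N => IHd.
  have := uE m.+1; rewrite /= IHd sub0r /inprod dfwith_out; last by rewrite neq_ltn; lia.
  by move=> /esym/eqP; rewrite oppr_eq0 => /eqP h; apply: (tinj m); rewrite h linear0.
have := uE l; rewrite /inprod dfwith_in => ->.
have -> : u l = 0 by have := high N; rewrite subnn addn0.
case: l {x x0 uE high} low => [|l] low /=; first by rewrite subr0.
by rewrite low // linear0 subr0.
Qed.

End DirectLimitInj.

Section LocalCohomologyPieces.
Variables (k : fieldType) (n : nat) (B : {mpoly k[n]} -> Prop).
Hypothesis hB : squarefree_monomial_ideal B.
Variables (F : forall l, resolution (monomial_power B l)).
Variables (c : forall l, reslift (F l.+1) (F l)) (i : nat).
Implicit Types (p q : 'rV[int]_n) (y : local_cohomology c i).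

Lemma Ext_to_lc_inj l : injective (Ext_to_lc c i l).
Proof. by apply: dirlim_map_inj => m; apply: Ext_map_inj. Qed.

Lemma Ext_to_lc_step l x : Ext_to_lc c i l.+1 (Ext_map (c l) i x) = Ext_to_lc c i l x.
Proof. exact: (dirlim_map_compat (fun l => Ext_map (c l) i)). Qed.

Lemma Ext_piece_push p l (x : Ext (F l) i) d : Ext_piece p x ->
  exists2 x' : Ext (F (d + l)%N) i, Ext_piece p x' &
    Ext_to_lc c i (d + l)%N x' = Ext_to_lc c i l x.
Proof.
move=> xp; elim: d => [|d [x' x'p x'E]]; first by exists x.
exists (Ext_map (c _) i x'); first exact: Ext_map_piece.
by rewrite Ext_to_lc_step.
Qed.

Lemma Ext_piece_descend p l d (x : Ext (F (d + l)%N) i) :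
  (forall j, - l%:Z <= p 0 j) -> Ext_piece p x ->
  exists2 x' : Ext (F l) i, Ext_piece p x' &
    Ext_to_lc c i l x' = Ext_to_lc c i (d + l)%N x.
Proof.
move=> lp; elim: d x => [|d IHd] x xp; first by exists x.
have lp' j : - (d + l)%:Z <= p 0 j by have := lp j; lia.
have [x' x'p <-] := Ext_map_piece_onto hB (c (d + l)) lp' xp.
have [x'' x''p x''E] := IHd x' x'p.
by exists x'' => //; rewrite x''E -Ext_to_lc_step.
Qed.

Lemma lc_piece_level p l y : (forall j, - l%:Z <= p 0 j) -> lc_piece p y ->
  exists2 x : Ext (F l) i, Ext_piece p x & y = Ext_to_lc c i l x.
Proof.
move=> lp [m [x xp ->]]; have [x' x'p <-] := Ext_piece_push l xp.
rewrite addnC in x' x'p *.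
by have [x'' x''p <-] := Ext_piece_descend lp x'p; exists x''.
Qed.

Lemma Ext_piece0 p l : Ext_piece p (0 : Ext (F l) i).
Proof.
exists 0; last by rewrite /hclass raddf0.
move=> j; rewrite [cycle_val _](_ : _ = 0) ?mxE; last exact: (raddf0 val).
by move=> m; rewrite msupp0.
Qed.

(** The vanishing of the component of degree [q] of [y], expressed at all large stages
    of the limit so that it is visibly closed under sums. *)
Definition avoids q y : Prop := exists l0, forall l, (l0 <= l)%N ->
  exists2 x : Ext (F l) i, component0 q x & y = Ext_to_lc c i l x.

Lemma avoids0 q : avoids q 0.
Proof.
by exists 0%N => l _; exists 0; [apply: component00 | rewrite raddf0].
Qed.

Lemma avoidsD q y y' : avoids q y -> avoids q y' -> avoids q (y + y').
Proof.
move=> [l0 h] [l1 h']; exists (maxn l0 l1) => l; rewrite geq_max => /andP[/h[x x0 ->]].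
move=> /h'[x' x'0 ->]; exists (x + x'); first exact: component0D.
by rewrite raddfD.
Qed.

Lemma avoids_sum q I (r : seq I) (f : I -> local_cohomology c i) :
  (forall s, avoids q (f s)) -> avoids q (\sum_(s <- r) f s).
Proof.
by move=> h; apply: big_ind => //; [apply: avoids0 | move=> ? ?; apply: avoidsD].
Qed.

(** A stage of the limit from which on [p] is at least [-l]. *)
Definition depth p : nat := \sum_j `|p 0%R j|%N.

Lemma depthP p l : (depth p <= l)%N -> forall j, - l%:Z <= p 0 j.
Proof.
by move=> pl j; move: pl; rewrite /depth (bigD1 j) //=; move: (\sum_(_ < _ | _) _)%N => s; lia.
Qed.

Lemma lc_piece_avoids p q y : lc_piece p y -> p != q -> avoids q y.
Proof.
move=> yp pq; exists (depth p) => l /depthP lp.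
have [x xp ->] := lc_piece_level lp yp; exists x => //.
exact: piece_component0 xp pq.
Qed.

(** The sum of the [H_p] is direct. *)
Lemma avoids_eq0 q y : lc_piece q y -> avoids q y -> y = 0.
Proof.
move=> yq [l0 h]; pose l := maxn l0 (depth q).
have [x x0 yx] := h l (leq_maxl _ _).
have [x' x'q yx'] := lc_piece_level (depthP (leq_maxr l0 (depth q))) yq.
have xx' : x = x' by apply: (@Ext_to_lc_inj l); rewrite -yx.
by rewrite yx' (piece_eq0 x'q) -?xx' // raddf0.
Qed.

Lemma lc_pieceZ p a y : lc_piece p y -> lc_piece p (a%:MP *: y).
Proof.
move=> [l [x xp ->]]; exists l, (a%:MP *: x); first exact: pieceZ.
by rewrite linearZ.
Qed.

(** One degree [p] with [H_p] nonzero suffices for [neg_set p] to belong to [Sigma_i],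
    by multiplication with monomials. *)
Lemma Sigma_neg_set p y : lc_piece p y -> y <> 0 -> Sigma c i (neg_set p).
Proof.
move=> yp y0 q qp; pose l := maxn (depth p) (depth q).
have lp := depthP (leq_maxl (depth p) (depth q)).
have lq := depthP (leq_maxr (depth p) (depth q)).
have [x xp yE] := lc_piece_level lp yp.
have [|x' x'q x'0] := Ext_piece_neg_set hB lp lq (esym qp) (F := F l) (i := i).
  by exists x => // x0; apply: y0; rewrite yE x0 raddf0.
exists (Ext_to_lc c i l x'); first by exists l, x'.
by move=> h; apply: x'0; apply: (@Ext_to_lc_inj l); rewrite h raddf0.
Qed.

End LocalCohomologyPieces.

(** * Fibres of the coarse grading *)
Section Slices.
Variables (n : nat) (M : zmodType) (rho : {additive M -> 'rV[int]_n}).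
Implicit Types (p q : 'rV[int]_n) (I : {set 'I_n}).

Lemma slice_neg_set I p q :
  slice rho I p q <-> (exists x, q = p + rho x) /\ neg_set q = I.
Proof.
split=> -[h1 h2]; split=> //.
  case: h2 => v vC ->; apply/setP => j; rewrite inE coordE.
  have := vC j; rewrite /p_ mxE.
  by case: (j \in I) => vj; lia.
exists (q - p_ I); last by rewrite addrC subrK.
move=> j; rewrite -h2 !coordE mxE inE.
by case: (ltP (q 0 j) 0) => qj; lia.
Qed.

(** A lower bound [a] of the coordinates makes their minimum exist, and then [f_] is
    not its default value. *)
Lemma f_ub I j p q a : (forall q', slice rho I p q' -> a <= q' 0 j) -> slice rho I p q ->
  - q 0 j <= (f_ rho I j p)%:Z.
Proof.
move=> sa sq.
pose P v := boolp.asbool (exists2 q', slice rho I p q' & q' 0 j = a + v%:Z).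
have exP : exists v, P v.
  exists `|q 0%R j - a|%N; apply/boolp.asboolP; exists q => //.
  by have := sa q sq; lia.
have [v /boolp.asboolP[q' sq' q'E] vmin] := ex_minnP exP.
have cm : coord_min (slice rho I p) j (q' 0 j).
  split; first by exists q'.
  move=> q1 sq1; rewrite q'E; have := sa q1 sq1 => aq1.
  have : (v <= `|q1 0%R j - a|)%N by apply: vmin; apply/boolp.asboolP; exists q1 => //; lia.
  by lia.
rewrite /f_; case: classical_sets.xgetP => [w _ [a' [_ a'min] wE]|none].
  by have := a'min q sq; rewrite wE; lia.
by case: (none `|(Num.max 0 (- q' 0 j))%R|%N); exists (q' 0 j) => //; lia.
Qed.

Lemma f_le I j p l : (forall q, slice rho I p q -> - q 0 j <= l%:Z) ->
  (f_ rho I j p <= l)%N.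
Proof.
move=> sl; rewrite /f_; case: classical_sets.xgetP => [w _ [a [[q sq <-] _] wE]|_ //].
by have := sl q sq; lia.
Qed.

Lemma bounded_in_polyhedron (R : realFieldType) (P : 'rV[int]_n -> Prop) (a : int) :
  (forall q, P q -> forall j, `|q 0 j| <= a) -> in_bounded_polyhedron R P.
Proof.
move=> Pa; exists (n + n)%N, (row_mx 1%:M (- 1%:M)), (const_mx a%:~R); split.
  exists a%:~R => x xa j; rewrite ler_norml.
  have := xa (lshift _ j); rewrite mul_mx_row row_mxEl mulmx1 mxE => ->.
  have := xa (rshift _ j); rewrite mul_mx_row row_mxEr mulmxN mulmx1 !mxE => h.
  by rewrite lerNl h.
move=> q /Pa qa s; rewrite mul_mx_row mulmxN mulmx1 -[s]splitK.
case: (split s) => j; rewrite /unsplit ?row_mxEl ?row_mxEr !mxE -?rmorphN ler_int;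
  by have := qa j; lia.
Qed.

End Slices.

(** * The comparison in degree delta *)
Section LocalCohomologyComparison.
Variables (k : fieldType) (n : nat) (B : {mpoly k[n]} -> Prop).
Hypothesis hB : squarefree_monomial_ideal B.
Variables (F : forall l, resolution (monomial_power B l)).
Variables (c : forall l, reslift (F l.+1) (F l)) (i : nat).
Variables (M D : zmodType) (rho : {additive M -> 'rV[int]_n}).
Variable phi : {additive 'rV[int]_n -> D}.
Hypothesis exact_mid : forall q, phi q = 0 <-> exists x : M, q = rho x.
Implicit Types (p q : 'rV[int]_n).

Lemma slice_phi I p q : slice rho I p q <-> phi q = phi p /\ neg_set q = I.
Proof.
rewrite slice_neg_set; have -> // : (exists x, q = p + rho x) <-> phi q = phi p.
have -> : (exists x, q = p + rho x) <-> phi (q - p) = 0.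
  rewrite exact_mid; split=> -[x xE]; exists x; first by rewrite xE addrC addKr.
  by rewrite -xE addrC subrK.
by rewrite raddfB; split=> [/eqP|->]; rewrite ?subrr // subr_eq0 => /eqP.
Qed.

Lemma coarse_piece1 delta p (y : local_cohomology c i) : phi p = delta -> lc_piece p y ->
  coarse_piece phi (@lc_piece _ _ _ F c i) delta y.
Proof.
by move=> pd yp; exists 1%N, (fun=> p), (fun=> y); split=> //; rewrite big_ord1.
Qed.

(** A finite basis of [H_delta] only involves finitely many degrees. *)
Lemma slice_bounded I p : Sigma c i I ->
  finite_dimensional (coarse_piece phi (@lc_piece _ _ _ F c i) (phi p)) ->
  exists a : int, forall q, slice rho I p q -> forall j, `|q 0 j| <= a.
Proof.
move=> SI [r [b [bP bspan]]].
have /boolp.choice [Ps PsP] : forall s : 'I_r, exists Ps : seq 'rV[int]_n,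
    forall q, q \notin Ps -> forall a, avoids q (a%:MP *: b s).
  move=> s; have [t [ps [y [yP ->]]]] := bP s.
  exists (codom ps) => q qps a; rewrite scaler_sumr; apply: avoids_sum => j.
  apply: (lc_piece_avoids hB (p := ps j)); first exact/lc_pieceZ/(yP j).2.
  by apply: contraNneq qps => <-; apply: codom_f.
pose Qs := flatten [seq Ps s | s <- enum 'I_r].
exists (\sum_(q <- Qs) \sum_j `|q 0 j|) => q /slice_phi[qp qI] j.
have [y yq y0] := SI q qI.
have qQs : q \in Qs.
  apply: contra_notT y0 => qQs; apply: (avoids_eq0 hB yq).
  have [a ->] := bspan y (coarse_piece1 qp yq).
  apply: avoids_sum => s; apply: PsP; apply: contraNN qQs => qs.
  by apply/flatten_mapP; exists s; rewrite ?mem_enum.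
rewrite (big_rem q) //= (bigD1 j) //= -addrA lerDl addr_ge0 //; apply: sumr_ge0 => // ? _.
exact: sumr_ge0.
Qed.

(** A component [y] of degree [q] over [delta] that does not come from stage [l] has
    [q_j < -l] for some [j]. If [y] were nonzero, then [q] would be in the slice of its
    negative set and [f_] would be larger than [l]. *)
Lemma Ext_eq_lc_of_f_max p l :
  (forall I, Sigma c i I ->
     exists a : int, forall q, slice rho I p q -> forall j, `|q 0 j| <= a) ->
  (f_max c i rho p <= l)%N -> Ext_eq_lc c i phi (phi p) l.
Proof.
move=> bd fl; split=> [x x' _ _|y [r [ps [ys [yP ->]]]]]; first exact: (Ext_to_lc_inj hB).
have /boolp.choice [xs xsP] : forall s : 'I_r, exists x : Ext (F l) i,
    Ext_piece (ps s) x /\ Ext_to_lc c i l x = ys s.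
  move=> s; have [psd yps] := yP s.
  have [lp|] := boolP [forall j, - l%:Z <= ps s 0 j].
    by have [x xp ->] := lc_piece_level hB (forallP lp) yps; exists x.
  rewrite negb_forall => /existsP[j]; rewrite -ltNge => pj.
  suff -> : ys s = 0.
    by exists 0; rewrite raddf0; split=> //; apply: Ext_piece0.
  apply: boolp.contrapT => ys0.
  have SI := Sigma_neg_set hB yps ys0; have [a aP] := bd _ SI.
  have sl : slice rho (neg_set (ps s)) p (ps s) by apply/slice_phi.
  have : - ps s 0 j <= (f_ rho (neg_set (ps s)) j p)%:Z.
    by apply: (f_ub (a := - a)) sl => q /aP/(_ j); lia.
  have : (f_ rho (neg_set (ps s)) j p <= l)%N.
    apply: leq_trans fl; rewrite /f_max.
    apply: (bigop.bigmax_sup (neg_set (ps s))); first exact/boolp.asboolP.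
    by apply: (bigop.bigmax_sup j) => //; rewrite inE; lia.
  by lia.
exists (\sum_s xs s).
  by exists r, ps, xs; split=> // s; split; [case: (yP s) | case: (xsP s)].
by rewrite raddf_sum; apply: eq_bigr => s _; case: (xsP s).
Qed.

(** Conversely, a point [q] of a slice with [q_j < -l] gives a nonzero [y] in [H_q],
    whereas the component of degree [q] of [Ext] at stage [l] is zero. *)
Lemma f_max_of_Ext_eq_lc p l : Ext_eq_lc c i phi (phi p) l -> (f_max c i rho p <= l)%N.
Proof.
move=> [_ onto]; apply/bigmax_leqP => I /boolp.asboolP SI; apply/bigmax_leqP => j jI.
apply: f_le => q /slice_phi[qp qI]; rewrite leNgt; apply/negP => ql.
have [y yq y0] := SI q qI; apply: y0; apply: (avoids_eq0 hB yq).
have [x [r [ps [xs [xP ->]]]] <-] := onto y (coarse_piece1 qp yq).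
rewrite raddf_sum; apply: avoids_sum => s; have [_ xp] := xP s.
have [psq|psq] := eqVneq (ps s) q; last first.
  by apply: (lc_piece_avoids hB (p := ps s)) => //; exists l, (xs s).
rewrite psq in xp; rewrite (Ext_piece_low hB (j := j) _ xp) ?raddf0; last by lia.
exact: avoids0.
Qed.

End LocalCohomologyComparison.

Theorem proposition3p1 (k : fieldType) (n : nat) (B : {mpoly k[n]} -> Prop)
  (hB : squarefree_monomial_ideal B)
  (F : forall l : nat, resolution (monomial_power B l))
  (c : forall l : nat, reslift (F l.+1) (F l))
  (M D : zmodType)
  (rho : {additive M -> 'rV[int]_n}) (phi : {additive 'rV[int]_n -> D})
  (rho_inj : injective rho)
  (exact_mid : forall q : 'rV[int]_n, phi q = 0 <-> exists x : M, q = rho x)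
  (phi_surj : forall delta : D, exists q : 'rV[int]_n, phi q = delta)
  (i : nat)
  (hfin : forall delta : D,
     finite_dimensional (coarse_piece phi (lc_piece (c := c) (i := i)) delta)) :
  (forall (R : realFieldType) (I : {set 'I_n}) (p : 'rV[int]_n),
     Sigma c i I -> in_bounded_polyhedron R (slice rho I p)) /\
  (forall (l : nat) (delta : D) (p : 'rV[int]_n), phi p = delta ->
     Ext_eq_lc c i phi delta l <-> (f_max c i rho p <= l)%N).
Proof.
have bd p I : Sigma c i I ->
    exists a : int, forall q, slice rho I p q -> forall j, `|q 0 j| <= a.
  by move=> SI; apply: (slice_bounded hB exact_mid SI (hfin (phi p))).
split=> [R I p SI|l delta p <-].
  by have [a aP] := bd p I SI; apply: bounded_in_polyhedron aP.
split; first exact: (f_max_of_Ext_eq_lc hB exact_mid).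
by apply: (Ext_eq_lc_of_f_max hB exact_mid) => I; apply: bd.
Qed.
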